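(* Assume that $\rho$ satisfies: $\rho\in H^2(0,\pi)$, $0<\rho(x)\le\beta_0$ for all $x\in[0,\pi]$ (for some constant $\beta_0$), and $\rho_0=\operatorname{ess\,inf}\eta_\rho>0$. Let $0<p<1$, let the boundary conditions be the general ones, i.e. $\alpha_1>0,\ \beta_1>0,\ \alpha_2>0,\ \beta_2>0$, and let $\mu$ be a real constant with $\mu\notin\Lambda(L)$ and $\mu>2\rho_4$, where $$\rho_4=\frac1\pi\Big(\frac{\alpha_1}{\beta_1}+\frac{\alpha_2}{\beta_2}+1+\int_0^\pi\eta_\rho(x)\,dx\Big).$$ Then the problem $$\rho(x)u_{tt}-(\rho(x)u_x)_x=\mu\rho(x)u+\rho(x)|u|^{p-1}u,\quad (t,x)\in\Omega,$$ $$a_1u(t,0)+b_1u_x(t,0)=0,\quad a_2u(t,\pi)+b_2u_x(t,\pi)=0,\quad t\in(0,T),$$ $$u(0,x)=u(T,x),\quad u_t(0,x)=u_t(T,x),\quad x\in(0,\pi),$$ has infinitely many periodic weak solutions $u_l$ satisfying $$\int_\Omega|u_l|^{p+1}\rho\,dt\,dx\to0\quad\text{as } l\to\infty.$$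
   Context: $T=2\pi a/b$ with $a,b$ relatively prime positive integers; $\Omega=(0,T)\times(0,\pi)$; $a_i,b_i\in\mathbb R$ with $a_i^2+b_i^2\ne0$ for $i=1,2$. Unknown functions $u$ are real-valued. $\eta_\rho=\frac12\frac{\rho''}{\rho}-\frac14\left(\frac{\rho'}{\rho}\right)^2$. Also $\alpha_1=a_1-\frac{b_1}{2}\frac{\rho'(0)}{\rho(0)}$, $\alpha_2=a_2-\frac{b_2}{2}\frac{\rho'(\pi)}{\rho(\pi)}$, $\beta_1=-b_1$, $\beta_2=b_2$. For $r\ge1$, $L^r(\Omega)$ is the space of $u$ with $\|u\|_{L^r(\Omega)}^r=\int_\Omega|u|^r\rho\,dt\,dx<\infty$. $\Psi$ is the set of functions $\psi$ that are $C^\infty$ on $\Omega$ up to the boundary and satisfy $a_1\psi(t,0)+b_1\psi_x(t,0)=0$, $a_2\psi(t,\pi)+b_2\psi_x(t,\pi)=0$, $\psi(0,x)=\psi(T,x)$, $\psi_t(0,x)=\psi_t(T,x)$. A function $u\in L^r(\Omega)$ is a weak solution of the problem if $\int_\Omega u(\rho\psi_{tt}-(\rho\psi_x)_x)\,dt\,dx-\int_\Omega(\mu u+|u|^{p-1}u)\psi\rho\,dt\,dx=0$ for all $\psi\in\Psi$. Let $\lambda_k^2$ be the eigenvalues (listed increasingly) of the Sturm–Liouville problem $-(\rho\varphi')'=\lambda^2\rho\varphi$ on $(0,\pi)$, $a_1\varphi(0)+b_1\varphi'(0)=0$, $a_2\varphi(\pi)+b_2\varphi'(\pi)=0$, and let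 $\nu_j=2\pi j/T$, $j\in\mathbb Z$. Then $\Lambda(L)$ denotes the set of all numbers $\lambda_{jk}=\lambda_k^2-\nu_j^2$; these are the eigenvalues of the wave operator $L$ (the self-adjoint extension to $L^2(\Omega)$ of $\psi\mapsto\rho^{-1}(\rho\psi_{tt}-(\rho\psi_x)_x)$, $\psi\in\Psi$). *)

(* Defs.v *)
From HB Require Import structures.
Set Warnings "-notation-overridden,-notation-incompatible-prefix".
From mathcomp Require Export all_boot all_order all_algebra.
From mathcomp Require Export all_classical all_reals all_analysis ess_sup_inf.
Export Order.TTheory GRing.Theory Num.Theory.
Export numFieldNormedType.Exports.

Set Implicit Arguments.
Unset Strict Implicit.
Unset Printing Implicit Defensive.

Local Open Scope classical_set_scope.
Local Open Scope ring_scope.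

Section OneDimension.
Context {R : realType}.
Implicit Types (rho drho ddrho f g phi : R -> R).

Local Notation leb := (@lebesgue_measure R).
Local Notation J := (`]0, pi[%classic : set R).
Local Notation Jbar := (`[0, pi]%classic : set R).

Definition square_integrable f :=
  measurable_fun J f /\ (\int[leb]_(x in J) ((f x) ^+ 2)%:E < +oo)%E.

(* The space C_c^oo(0, pi), its elements being extended by 0 to R. *)
Definition compact_test_function phi :=
  (forall n x, derivable (derive1n n phi) x 1) /\
  exists c d : R, [/\ 0 < c, d < pi & forall x, ~~ (c <= x <= d) -> phi x = 0].

Definition weak_derivative f g :=
  forall phi, compact_test_function phi ->
    Rintegral leb J (fun x => f x * derive1 phi x) =
    - Rintegral leb J (fun x => g x * phi x).

(* rho \in H^2(0, pi), where drho and ddrho are its first and second weak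
   derivatives.  The classes rho and drho are given by their continuous
   representatives on [0, pi] (H^2 embeds in C^1), which is what gives a meaning
   to rho(x), rho'(0) and rho'(pi); ddrho is determined a.e. only. *)
Definition H2 rho drho ddrho :=
  [/\ {within Jbar, continuous rho} /\ {within Jbar, continuous drho},
      square_integrable rho, square_integrable drho, square_integrable ddrho
    & weak_derivative rho drho /\ weak_derivative drho ddrho].

Definition eta rho drho ddrho (x : R) : R :=
  2^-1 * (ddrho x / rho x) - 4^-1 * (drho x / rho x) ^+ 2.

Definition rho0 rho drho ddrho : \bar R :=
  ess_inf (mrestr leb (measurable_itv `]0, (pi : R)[))
    (fun x => (eta rho drho ddrho x)%:E).

Definition alpha1 rho drho (a1 b1 : R) : R :=
  a1 - b1 / 2 * (drho 0 / rho 0).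

Definition alpha2 rho drho (a2 b2 : R) : R :=
  a2 - b2 / 2 * (drho pi / rho pi).

Definition beta1 (b1 : R) : R := - b1.

Definition beta2 (b2 : R) : R := b2.

Definition rho4 rho drho ddrho (a1 b1 a2 b2 : R) : R :=
  pi^-1 * (alpha1 rho drho a1 b1 / beta1 b1 + alpha2 rho drho a2 b2 / beta2 b2
           + 1 + Rintegral leb J (eta rho drho ddrho)).

(* dphi is the derivative of phi, extended continuously to [0, pi]; lam2 is
   the eigenvalue itself, that is the number denoted lambda^2. *)
Definition sturm_liouville_eigenvalue rho (a1 b1 a2 b2 lam2 : R) :=
  exists phi dphi : R -> R,
  [/\ {within Jbar, continuous phi} /\ {within Jbar, continuous dphi},
      forall x, J x -> is_derive x 1 phi (dphi x),
      forall x, J x ->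
        is_derive x 1 (fun y => rho y * dphi y) (- (lam2 * rho x * phi x)),
      a1 * phi 0 + b1 * dphi 0 = 0 /\ a2 * phi pi + b2 * dphi pi = 0
    & exists2 x, Jbar x & phi x != 0].

(* The set Lambda(L) of all the lambda_k^2 - nu_j^2. *)
Definition Lambda rho (a1 b1 a2 b2 T : R) : set R :=
  [set l | exists (lam2 : R) (j : int),
     sturm_liouville_eigenvalue rho a1 b1 a2 b2 lam2 /\
     l = lam2 - (2 * pi * j%:~R / T) ^+ 2].

End OneDimension.

Section TwoDimensions.
Context {R : realType}.
Implicit Types (rho : R -> R) (u v : R * R -> R) (T : R).

Local Notation leb2 := (@lebesgue_measure R \x @lebesgue_measure R)%E.

(* Points of R * R are the pairs (t, x). *)
Definition Omega T : set (R * R) := `]0, T[%classic `*` `]0, pi[%classic.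

Definition Omega_bar T : set (R * R) := `[0, T]%classic `*` `[0, pi]%classic.

(* psi 0 0 is C^oo on Omega up to the boundary: psi m n is its derivative
   of order m in t and n in x, extended continuously to the closure of Omega. *)
Definition smooth_up_to_boundary T (psi : nat -> nat -> R * R -> R) :=
  forall m n,
  [/\ {within Omega_bar T, continuous (psi m n)},
      forall t x, Omega T (t, x) ->
        is_derive t 1 (fun s => psi m n (s, x)) (psi m.+1 n (t, x))
    & forall t x, Omega T (t, x) ->
        is_derive x 1 (fun y => psi m n (t, y)) (psi m n.+1 (t, x))].

Definition Psi T (a1 b1 a2 b2 : R) (psi : nat -> nat -> R * R -> R) :=
  [/\ smooth_up_to_boundary T psi,
      forall t, 0 <= t <= T ->
        a1 * psi 0 0 (t, 0) + b1 * psi 0 1 (t, 0) = 0,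
      forall t, 0 <= t <= T ->
        a2 * psi 0 0 (t, pi) + b2 * psi 0 1 (t, pi) = 0,
      forall x, 0 <= x <= pi -> psi 0 0 (0, x) = psi 0 0 (T, x)
    & forall x, 0 <= x <= pi -> psi 1 0 (0, x) = psi 1 0 (T, x)].

(* The integral of |u|^r rho, that is the r-th power of the norm of L^r(Omega). *)
Definition Lr_integral T rho (r : R) u : \bar R :=
  (\int[leb2]_(z in Omega T) (`|u z| `^ r * rho z.2)%:E)%E.

Definition in_Lr T rho (r : R) u :=
  measurable_fun (Omega T) u /\ (Lr_integral T rho r u < +oo)%E.

Definition ae_equal T u v :=
  {ae leb2, forall z, Omega T z -> u z = v z}.

(* As powR 0 (p - 1) = 0 for p < 1, the term |u|^(p-1) u vanishes where u does. *)
Definition weak_solution T rho (a1 b1 a2 b2 mu p r : R) u :=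
  [/\ 1 <= r, in_Lr T rho r u
    & forall psi, Psi T a1 b1 a2 b2 psi ->
      Rintegral leb2 (Omega T) (fun z =>
        u z * (rho z.2 * psi 2 0 z
               - derive1 (fun y => rho y * psi 0 1 (z.1, y)) z.2))
      - Rintegral leb2 (Omega T) (fun z =>
        (mu * u z + `|u z| `^ (p - 1) * u z) * psi 0 0 z * rho z.2) = 0].

End TwoDimensions.

(* Main.v *)
From mathcomp Require Import ring lra.
Require Import Defs.

Set Implicit Arguments.
Unset Strict Implicit.
Unset Printing Implicit Defensive.

Local Open Scope classical_set_scope.
Local Open Scope ring_scope.

(** Functions w(x) of the space variable alone satisfy the periodicity conditions
    for every T, so it suffices to find stationary solutions: with v = rho w',
    those of the planar system

      w' = v / rho,   v' = - rho (mu w + |w|^(p-1) w)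

    subject to the two boundary conditions.  Since p < 1, the restoring force is
    infinitely steep at the origin: the smaller a trajectory, the faster it
    turns around the origin.  A trajectory of moderate size turns by a bounded
    angle over [0, pi], a very small one by more than an additional half-turn,
    and by continuity some trajectory in between meets the boundary condition at
    pi.  This gives nontrivial stationary solutions of arbitrarily small sup
    norm ([small_stationary_solution]); a sequence in which each solution is
    smaller than the value at 0 of the preceding ones consists of pairwise
    distinct functions whose norms tend to zero.

    The force is not Lipschitz at the origin, and continuous dependence on
    initial values is not available directly.  The shooting is therefore done
    for forces truncated to slope n ([shooting]), for which polar coordinates
    make the right-hand side globally Lipschitz ([prufer_flow]).  All bounds have
    to be uniform in n.  For the radius they come from the energy
    v^2/2 + rho^2 G(w), whose logarithmic derivative is at most 2 |rho'| / rho
    ([energy_estimate]); for the angle, from the fact that its speed is at least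
    a multiple of cos^2 + k^2 sin^2 as soon as the force has slope at least k^2
    ([rotation_ge]).  The truncated solutions are equi-Lipschitz, and a limit
    along an ultrafilter, taken pointwise, solves the original equation.

    The weak derivative of rho has a continuous representative, which by
    du Bois-Reymond's lemma is the classical derivative of rho on (0, pi)
    ([weak_derivative_is_derive]); the energy estimate and the integration by
    parts against test functions both rest on it.  The weak formulation
    then follows from Fubini's theorem and two integrations by parts
    ([stationary_weak_solution]).  The force is restoring because
    mu > 0, a consequence of mu > 2 rho_4 and eta_rho > 0. *)

(** * Calculus on the real line *)

Lemma within_continuous_retract (T U V : topologicalType) (A : set T)
    (B : set U) (r : U -> T) (f : T -> V) :
  continuous r -> (forall u, B u -> A (r u)) ->
  {within A, continuous f} -> {within B, continuous (fun u => f (r u))}.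
Proof.
move=> cr Ar /subspace_continuousP cf; apply/subspace_continuousP => u Bu.
apply: (@cvg_comp _ _ _ r f (within B (nbhs u)) (within A (nbhs (r u)))).
  move=> C HC; have H : nbhs u (fun z => A (r z) -> C (r z)) := cr u _ HC.
  by apply: filterS H => z h Bz; apply: h; exact: Ar.
exact: (cf _ (Ar u Bu)).
Qed.

Lemma within_continuousT (T U : topologicalType) (f : T -> U) :
  {within setT, continuous f} -> continuous f.
Proof.
by move=> cf x; move: (cf x); rewrite {1}/continuous_at nbhs_subspaceT.
Qed.

Section Within.
Context {R : realType} {T : topologicalType}.
Variable A : set T.
Implicit Types f g : T -> R.

Lemma within_continuousD f g : {within A, continuous f} ->
  {within A, continuous g} -> {within A, continuous (fun x => f x + g x)}.
Proof. by move=> cf cg x; exact: (continuousD (cf x) (cg x)). Qed.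

Lemma within_continuousB f g : {within A, continuous f} ->
  {within A, continuous g} -> {within A, continuous (fun x => f x - g x)}.
Proof. by move=> cf cg x; exact: (continuousB (cf x) (cg x)). Qed.

Lemma within_continuousM f g : {within A, continuous f} ->
  {within A, continuous g} -> {within A, continuous (fun x => f x * g x)}.
Proof. by move=> cf cg x; exact: (continuousM (cf x) (cg x)). Qed.

Lemma within_continuous_cst (k : R) : {within A, continuous (fun=> k)}.
Proof. by apply: continuous_subspaceT => x; exact: cst_continuous. Qed.

Lemma within_continuous_comp f (g : R -> R) : {within A, continuous f} ->
  continuous g -> {within A, continuous (fun x => g (f x))}.
Proof.
move=> cf cg x.
exact: (@continuous_comp (subspace A) R R f g x (cf x) (cg (f x))).
Qed.

End Within.

Section Calculus.
Context {R : realType}.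
Implicit Types (f g h F df dh : R -> R) (a b d x y : R).

Lemma is_derive_cont f x d : is_derive x 1 f d -> {for x, continuous f}.
Proof.
by move=> [df _]; exact/differentiable_continuous/derivable1_diffP.
Qed.

Lemma is_derive_addf f g x a b :
  is_derive x 1 f a -> is_derive x 1 g b ->
  is_derive x 1 (fun y => f y + g y) (a + b).
Proof. by move=> fa gb; exact: is_deriveD. Qed.

Lemma is_derive_subf f g x a b :
  is_derive x 1 f a -> is_derive x 1 g b ->
  is_derive x 1 (fun y => f y - g y) (a - b).
Proof. by move=> fa gb; exact: is_deriveB. Qed.

Lemma is_derive_oppf f x a :
  is_derive x 1 f a -> is_derive x 1 (fun y => - f y) (- a).
Proof. by move=> fa; exact: is_deriveN. Qed.

Lemma is_derive_mulf f g x a b :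
  is_derive x 1 f a -> is_derive x 1 g b ->
  is_derive x 1 (fun y => f y * g y) (a * g x + f x * b).
Proof.
move=> fa gb; apply: (is_derive_eq (is_deriveM fa gb)).
by rewrite /GRing.scale /= addrC mulrC.
Qed.

Lemma is_derive_scalef (k : R) f x a :
  is_derive x 1 f a -> is_derive x 1 (fun y => k * f y) (k * a).
Proof. by move=> fa; exact: is_deriveZ. Qed.

Lemma is_derive_invf f x a : f x != 0 -> is_derive x 1 f a ->
  is_derive x 1 (fun y => (f y)^-1) (- a / f x ^+ 2).
Proof.
move=> fx fa; apply: (is_derive_eq (is_deriveV fx fa)).
by rewrite /GRing.scale /= mulrC mulNr mulrN.
Qed.

Lemma is_derive_compf f g x a b :
  is_derive (g x) 1 f a -> is_derive x 1 g b ->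
  is_derive x 1 (fun y => f (g y)) (a * b).
Proof. by move=> fa gb; exact: is_derive1_comp. Qed.

Lemma is_derive_cstf (k : R) x : is_derive x 1 (fun=> k) 0.
Proof. exact: is_derive_cst. Qed.

Lemma is_derive_idf x : is_derive x 1 (fun y : R => y) 1.
Proof. exact: is_derive_id. Qed.

Lemma ge0_is_derive_le f df a b : a <= b ->
  (forall x, a < x < b -> is_derive x 1 f (df x)) ->
  (forall x, a < x < b -> 0 <= df x) ->
  {within `[a, b], continuous f} -> f a <= f b.
Proof.
rewrite le_eqVlt => /predU1P[->//|ab] fdf df0 cf.
have fdf' x : x \in `]a, b[ -> is_derive x 1 f (df x) by rewrite in_itv; exact: fdf.
have [c /[!in_itv]/= cab fE] := MVT ab fdf' cf.
by rewrite -subr_ge0 fE mulr_ge0 ?df0// subr_ge0 ltW.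
Qed.

Lemma norm_is_derive_le f df h dh a b : a <= b ->
  (forall x, a < x < b -> is_derive x 1 f (df x)) ->
  (forall x, a < x < b -> is_derive x 1 h (dh x)) ->
  (forall x, a < x < b -> `|df x| <= dh x) ->
  {within `[a, b], continuous f} -> {within `[a, b], continuous h} ->
  `|f b - f a| <= h b - h a.
Proof.
move=> ab fdf hdh dfh cf ch; rewrite ler_norml; apply/andP; split.
- suff : h a + f a <= h b + f b by lra.
  apply: (@ge0_is_derive_le (fun x => h x + f x) (fun x => dh x + df x)) => //.
  + by move=> x xab; apply: is_derive_addf; [exact: hdh|exact: fdf].
  + by move=> x /dfh; rewrite ler_norml; lra.
  + by move=> x; apply: continuousD; [exact: ch|exact: cf].
- suff : h a - f a <= h b - f b by lra.
  apply: (@ge0_is_derive_le (fun x => h x - f x) (fun x => dh x - df x)) => //.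
  + by move=> x xab; apply: is_derive_subf; [exact: hdh|exact: fdf].
  + by move=> x /dfh; rewrite ler_norml; lra.
  + by move=> x; apply: continuousB; [exact: ch|exact: cf].
Qed.

Lemma lipschitz_is_derive f df a b (K : R) : a <= b ->
  (forall x, a < x < b -> is_derive x 1 f (df x)) ->
  (forall x, a < x < b -> `|df x| <= K) ->
  {within `[a, b], continuous f} -> `|f b - f a| <= K * (b - a).
Proof.
move=> ab fdf dfK cf; rewrite mulrBr.
apply: (@norm_is_derive_le f df (fun x => K * x) (fun=> K * 1) a b ab fdf) => //.
- by move=> x /dfK; rewrite mulr1.
- apply: continuous_subspaceT => x.
  exact: (is_derive_cont (is_derive_scalef K (is_derive_idf x))).
Qed.

Lemma continuous_within_lipschitz f (A : set R) (K : R) : 0 < K ->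
  (forall x y, A x -> A y -> `|f y - f x| <= K * `|y - x|) ->
  {within A, continuous f}.
Proof.
move=> K0 fK; apply/subspace_continuousP => x Ax.
apply/cvgrPdist_le => /= e e0; rewrite near_withinE; near=> z => Az.
apply: le_trans (fK _ _ Az Ax) _; rewrite mulrC -ler_pdivlMr//; near: z.
by apply: cvgr_dist_le; [exact: cvg_id|exact: divr_gt0].
Unshelve. all: by end_near. Qed.

Lemma norm_sinB x y : `|sin x - sin y| <= `|x - y|.
Proof.
wlog xy : x y / y <= x.
  move=> H; case: (leP y x) => [/H//|/ltW /H].
  by rewrite distrC (distrC y).
rewrite [leRHS]ger0_norm ?subr_ge0// -[leRHS]mul1r.
apply: (@lipschitz_is_derive _ cos) => //.
  by move=> z _; rewrite ler_norml cos_geN1 cos_le1.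
by apply: continuous_subspaceT; exact: continuous_sin.
Qed.

Lemma norm_cosB x y : `|cos x - cos y| <= `|x - y|.
Proof.
wlog xy : x y / y <= x.
  move=> H; case: (leP y x) => [/H//|/ltW /H].
  by rewrite distrC (distrC y).
rewrite [leRHS]ger0_norm ?subr_ge0// -[leRHS]mul1r.
apply: (@lipschitz_is_derive _ (fun z => - sin z)) => //.
  by move=> z _; rewrite normrN ler_norml sin_geN1 sin_le1.
by apply: continuous_subspaceT; exact: continuous_cos.
Qed.

Lemma Rintegral_antiderivative_shift f a b x y : continuous f ->
  a <= b -> b <= x -> b <= y ->
  Rintegral lebesgue_measure `[a, x]%classic f -
  Rintegral lebesgue_measure `[a, y]%classic f =
  Rintegral lebesgue_measure `[b, x]%classic f -
  Rintegral lebesgue_measure `[b, y]%classic f.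
Proof.
move=> cf ab bx byy.
have fi (c d : R) : lebesgue_measure.-integrable `[c, d] (EFin \o f).
  apply: continuous_compact_integrable; first exact: segment_compact.
  exact: continuous_subspaceT.
have E z : b <= z -> Rintegral lebesgue_measure `[a, z]%classic f =
    Rintegral lebesgue_measure `[b, z]%classic f +
    Rintegral lebesgue_measure `[a, b]%classic f.
  move=> bz; rewrite -[in RHS]Rintegral_itv_obnd_cbnd; last first.
    by apply: integrableS (fi b z) => //; exact: subset_itv_oc_cc.
  by rewrite -(@Rintegral_itvB _ _ (BLeft a) (BRight z) b) ?bnd_simp// subrK.
by rewrite (E x)// (E y)// opprD addrACA subrr addr0.
Qed.

(** The integral from a base point differentiates to the integrand only to the
    right of that point; letting the base point recede with the argument gives
    a primitive on the whole line. *)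
Lemma antiderivative f : continuous f ->
  exists F, F 0 = 0 /\ forall x, is_derive x 1 F (f x).
Proof.
move=> cf.
pose P a x := Rintegral lebesgue_measure `[a, x]%classic f.
pose F x := P (- (`|x| + 1)) x - P (- (`|x| + 1)) 0.
exists F; split=> [|x0]; first by rewrite /F subrr.
pose N := `|x0| + 2.
have FE x : - N < x -> F x = P (- N) x - P (- N) 0.
  move=> Nx; rewrite /F.
  have ? : - (`|x| + 1) <= x by rewrite lerNl; have := ler_norm (- x); rewrite normrN; lra.
  have ? : - (`|x| + 1) <= 0 by have := normr_ge0 x; lra.
  have ? : - N <= 0 by rewrite /N; have := normr_ge0 x0; lra.
  case: (leP (- N) (- (`|x| + 1))) => H.
    by apply/esym/Rintegral_antiderivative_shift.
  by apply/Rintegral_antiderivative_shift => //; apply: ltW.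
have Nx0 : - N < x0 by rewrite /N; have := ler_norm (- x0); rewrite normrN; lra.
have [] := @continuous_FTC1_closed R f (- N) x0 (x0 + 1).
- by rewrite ltrDl.
- apply: continuous_compact_integrable; first exact: segment_compact.
  exact: continuous_subspaceT.
- exact: Nx0.
- exact: cf.
move=> dP PE.
apply: (@near_eq_is_derive R R R (fun x => P (- N) x - P (- N) 0)) => //.
  by apply: filterS (lt_nbhsr Nx0) => x Nx; rewrite FE.
apply: (is_derive_eq (is_derive_subf (derivableP dP) (is_derive_cstf _ _))).
by rewrite subr0 -derive1E PE.
Qed.

(** A pointwise limit of differentiable functions along a filter is
    differentiable when the derivatives are equicontinuous at the point: by the
    mean value theorem the difference quotients are then uniformly close to the
    derivatives, and this estimate survives in the limit.  No uniform
    convergence is involved, so that the lemma applies to ultrafilters. *)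
Lemma is_derive_lim (T : Type) (G : set_system T) {PG : ProperFilter G}
    (fn dn : T -> R -> R) f (d a b x : R) : a < x < b ->
  (forall n y, a < y < b -> is_derive y 1 (fn n) (dn n y)) ->
  (forall y, a < y < b -> fn n y @[n --> G] --> f y) ->
  dn n x @[n --> G] --> d ->
  (forall e : R, 0 < e -> exists2 r : R, 0 < r &
     \forall n \near G, forall y, a < y < b -> `|y - x| <= r ->
       `|dn n y - dn n x| <= e) ->
  is_derive x 1 f d.
Proof.
move=> /andP[ax xb] fdn fnf dnd equi.
(* The mean value theorem for fn n minus its linear part at x, on either side. *)
have mv n y (r e : R) : a < y < b -> `|y - x| <= r ->
    (forall z, a < z < b -> `|z - x| <= r -> `|dn n z - dn n x| <= e) ->
    `|fn n y - fn n x - dn n x * (y - x)| <= e * `|y - x|.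
  move=> /andP[ay yb] yr H.
  pose k z := fn n z - dn n x * z.
  have kd z : a < z < b -> is_derive z 1 k (dn n z - dn n x).
    move=> zab; apply: is_derive_subf; first exact: fdn.
    by apply: (is_derive_eq (is_derive_scalef (dn n x) (is_derive_idf z))); rewrite mulr1.
  have kc u v : a < u -> v < b -> {within `[u, v], continuous k}.
    move=> au vb; apply: derivable_within_continuous => z /[!in_itv]/= /andP[uz zv].
    by have [] := kd z _; [rewrite (lt_le_trans au)//= (le_lt_trans zv)|].
  have -> : fn n y - fn n x - dn n x * (y - x) = k y - k x by rewrite /k; ring.
  case: (leP x y) => xy.
    rewrite [in leRHS]ger0_norm ?subr_ge0//.
    apply: (@lipschitz_is_derive k (fun z => dn n z - dn n x)) => //.
    - by move=> z /andP[xz zy]; apply: kd; rewrite (lt_trans ax)//= (lt_trans zy).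
    - move=> z /andP[xz zy]; apply: H; first by rewrite (lt_trans ax)//= (lt_trans zy).
      by apply: le_trans yr; rewrite !ger0_norm ?subr_ge0 ?(ltW xz)// lerB// ltW.
    - exact: kc.
  rewrite distrC [`|y - x|]distrC [in leRHS]ger0_norm ?subr_ge0 ?(ltW xy)//.
  apply: (@lipschitz_is_derive k (fun z => dn n z - dn n x)) => //.
  - exact: ltW.
  - by move=> z /andP[xz zy]; apply: kd; rewrite (lt_trans ay)//= (lt_trans zy).
  - move=> z /andP[xz zy]; apply: H; first by rewrite (lt_trans ay)//= (lt_trans zy).
    apply: le_trans yr; rewrite distrC (distrC y) !ger0_norm ?subr_ge0 ?(ltW zy) ?(ltW xy)//.
    by rewrite lerB// ltW.
  - exact: kc.
apply/is_derive1_caratheodory.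
exists (fun z => if z == x then d else (f z - f x) / (z - x)); split.
- by move=> z; case: eqP => [->|/eqP]; [rewrite !subrr mulr0|rewrite -subr_eq0 => /divfK->].
- apply/cvgrPdist_le => /= e e0; rewrite eqxx.
  have [r r0 Hr] := equi e e0.
  have : \forall z \near x, a < z < b /\ `|z - x| <= r.
    near=> z; split.
      by apply/andP; split; near: z; [exact: lt_nbhsr|exact: lt_nbhsl].
    by near: z; apply: cvgr_distC_le => //; exact: cvg_id.
  apply: filterS => z [zab zr].
  case: eqP => [_|/eqP zx]; first by rewrite subrr normr0 ltW.
  rewrite distrC -(@ler_pM2r _ `|z - x|) ?normr_gt0 ?subr_eq0//.
  rewrite -normrM mulrBl divfK ?subr_eq0//.
  have L : `|fn n z - fn n x - dn n x * (z - x)| @[n --> G] --> `|f z - f x - d * (z - x)|.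
    apply: cvg_norm; apply: cvgB; first by apply: cvgB; apply: fnf; rewrite ?ax.
    by apply: cvgMl.
  rewrite -(cvg_lim _ L)//; apply: limr_le; first by apply/cvg_ex; eexists; exact: L.
  by apply: filterS Hr => n Hn; apply: mv zab zr Hn.
- by rewrite eqxx.
Unshelve. all: by end_near. Qed.

Lemma integral_FTC_oo f F a b : a < b ->
  {within `[a, b], continuous f} -> {within `[a, b], continuous F} ->
  (forall x, a < x < b -> is_derive x 1 F (f x)) ->
  (\int[lebesgue_measure]_(x in `]a, b[) (f x)%:E)%E = (F b - F a)%:E.
Proof.
move=> ab cf cF dF.
have mf : measurable_fun `[a, b]%classic f.
  exact: measurable_realfun.subspace_continuous_measurable_fun.
rewrite integral_itv_obnd_cbnd; last first.
  by apply/measurable_realfun.measurable_EFinP; apply: measurable_funS mf => //; exact: subset_itv_oo_cc.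
rewrite integral_itv_bndo_bndc; last first.
  by apply/measurable_realfun.measurable_EFinP; apply: measurable_funS mf => //; exact: subset_itv_co_cc.
have [_ Fa Fb] := (continuous_within_itvP F ab).1 cF.
rewrite (@continuous_FTC2 _ f F)//.
- by split=> // x /[!in_itv]/= xab; have [] := dF x xab.
- by move=> x /[!in_itv]/= xab; rewrite derive1E; have [_ ->] := dF x xab.
Qed.

End Calculus.

Section Clamp.
Context {R : realType}.
Implicit Types (a b x : R) (f : R -> R).

Definition clamp a b x := Num.max a (Num.min x b).

Lemma clamp_continuous a b : continuous (clamp a b).
Proof.
move=> x; apply: (@continuous_max _ _ (cst a) (fun x => Num.min x b)).
  exact: cvg_cst.
by apply: (@continuous_min _ _ id (cst b)); [exact: cvg_id|exact: cvg_cst].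
Qed.

Lemma clamp_itv a b x : a <= b -> a <= clamp a b x <= b.
Proof. by move=> ab; rewrite /clamp le_max lexx/= ge_max ab/= ge_min lexx orbT. Qed.

Lemma clamp_id a b x : a <= x <= b -> clamp a b x = x.
Proof. by move=> /andP[ax xb]; rewrite /clamp min_l// max_r. Qed.

Lemma continuous_clamp f a b : a <= b -> {within `[a, b], continuous f} ->
  continuous (fun x => f (clamp a b x)).
Proof.
move=> ab cf; apply: within_continuousT.
apply: (within_continuous_retract (A := `[a, b]%classic)) => //.
  exact: clamp_continuous.
by move=> u _; rewrite /= in_itv/= clamp_itv.
Qed.

Lemma bounded_within f a b : a <= b -> {within `[a, b], continuous f} ->
  exists2 M : R, 0 < M & forall x, a <= x <= b -> `|f x| <= M.
Proof.
move=> ab cf; have [c _ fc] := EVT_max ab cf; have [d _ fd] := EVT_min ab cf.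
exists (`|f c| + `|f d| + 1); first by have := normr_ge0 (f c); have := normr_ge0 (f d); lra.
move=> x xab; have x' : x \in `[a, b] by rewrite in_itv.
have := fc x x'; have := fd x x'.
by have := ler_norm (f c); have := ler_norm (- f d); rewrite normrN ler_norml;
  have := normr_ge0 (f c); have := normr_ge0 (f d); lra.
Qed.

Lemma positive_within f a b : a <= b -> {within `[a, b], continuous f} ->
  (forall x, a <= x <= b -> 0 < f x) ->
  exists2 m : R, 0 < m & forall x, a <= x <= b -> m <= f x.
Proof.
move=> ab cf f0; have [d dab fd] := EVT_min ab cf.
exists (f d); first by apply: f0; move: dab; rewrite in_itv.
by move=> x xab; apply: fd; rewrite in_itv.
Qed.

End Clamp.

(** * The Cauchy problem *)

Section CauchyProblem.
Context {R : realType}.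

(** Adding and subtracting the tail of the geometric series makes the sequence
    monotone from above and from below, which yields the limit together with the
    rate of convergence. *)
Lemma geometric_limit (u : nat -> R) (E : R) :
  (forall k, `|u k.+1 - u k| <= 2^-1 ^+ k * E) ->
  exists l, forall k, `|u k - l| <= 2 * 2^-1 ^+ k * E.
Proof.
move=> uE.
have E0 : 0 <= E by have := le_trans (normr_ge0 _) (uE 0%N); rewrite expr0 mul1r.
pose a k := u k - 2 * 2^-1 ^+ k * E.
pose b k := u k + 2 * 2^-1 ^+ k * E.
have aS k : a k <= a k.+1.
  by have := uE k; rewrite /a exprS ler_norml; lra.
have bS k : b k.+1 <= b k.
  by have := uE k; rewrite /b exprS ler_norml; lra.
have aD k m : a k <= a (k + m)%N.
  by elim: m => [|m IH]; rewrite ?addn0// addnS (le_trans IH).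
have bD k m : b (k + m)%N <= b k.
  by elim: m => [|m IH]; rewrite ?addn0// addnS (le_trans _ IH).
have ab k m : a k <= b m.
  apply: le_trans (aD k m) _; rewrite addnC; apply: le_trans (bD m k).
  rewrite /a /b; have : 0 <= 2^-1 ^+ (m + k) * E by rewrite mulr_ge0 ?exprn_ge0 ?invr_ge0.
  lra.
have supa : has_sup (range a).
  by split; [exists (a 0%N), 0%N|exists (b 0%N) => _ [k _ <-]].
exists (sup (range a)) => k.
have : a k <= sup (range a) by apply: sup_upper_bound => //; exists k.
have : sup (range a) <= b k.
  by apply: ge_sup; [exists (a 0%N), 0%N|move=> _ [m _ <-]].
by rewrite /a /b ler_norml; lra.
Qed.

Section Picard.
Variable I : Type.
Implicit Types (A B : I -> R) (x s t a b d : R).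
Variables (L : R) (f : I -> R -> (I -> R) -> R).
Hypothesis L0 : 0 < L.
Hypothesis f_bounded : forall i x y, `|f i x y| <= L.
Hypothesis f_lipschitz : forall i x (y z : I -> R) (d : R),
  (forall j, `|y j - z j| <= d) -> `|f i x y - f i x z| <= L * d.
Hypothesis f_continuous : forall i (y : I -> R -> R),
  (forall j, continuous (y j)) -> continuous (fun s : R => f i s (y ^~ s)).

Arguments f_bounded : clear implicits.
Arguments f_lipschitz : clear implicits.
Arguments f_continuous : clear implicits.

Let prim (g : R -> R) : R -> R :=
  xget (fun=> 0) [set G : R -> R | G 0 = 0 /\ forall x : R, is_derive x 1 G (g x)].

Let primP (g : R -> R) : continuous g ->
  prim g 0 = 0 /\ forall x : R, is_derive x 1 (prim g) (g x).
Proof. by move=> /antiderivative; exact: xgetPex. Qed.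

Fixpoint picard_iterate k (A : I -> R) : I -> R -> R :=
  if k is k'.+1 then
    fun i x => A i + prim (fun s : R => f i s (picard_iterate k' A ^~ s)) x
  else fun i _ => A i.

Let y := picard_iterate.

Let y_continuous k A i : continuous (y k A i).
Proof.
elim: k i => [|k IH] i; first by move=> x; exact: cvg_cst.
have [_ H] := primP (f_continuous i _ IH).
by move=> x; apply: cvgD; [exact: cvg_cst|exact: (is_derive_cont (H x))].
Qed.

Arguments y_continuous : clear implicits.

Let dy k A i x : is_derive x 1 (y k.+1 A i) (f i x (y k A ^~ x)).
Proof.
have [_ H] := primP (f_continuous i _ (y_continuous k A)).
apply: (is_derive_eq (is_derive_addf (is_derive_cstf (A i) x) (H x))).
by rewrite add0r.
Qed.

Let y0 k A i : y k A i 0 = A i.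
Proof.
case: k => //= k; have [-> _] := primP (f_continuous i _ (y_continuous k A)).
by rewrite addr0.
Qed.

Let y_lip k A i a b : `|y k A i b - y k A i a| <= L * `|b - a|.
Proof.
wlog ab : a b / a <= b.
  move=> H; case: (leP a b) => [/H//|/ltW/H].
  by rewrite distrC (distrC a).
case: k => [|k]; first by rewrite subrr normr0 mulr_ge0// ltW.
rewrite [`|b - a|]ger0_norm ?subr_ge0//.
apply: (lipschitz_is_derive ab (fun x _ => dy k A i x) (fun x _ => f_bounded _ _ _)).
exact/continuous_subspaceT/y_continuous.
Qed.

Arguments dy : clear implicits.
Arguments y_lip : clear implicits.

Let expd (c k x : R) : is_derive x 1 (fun s : R => c * expR (k * s)) (c * (k * expR (k * x))).
Proof.
have H := is_derive_compf (is_derive_expR (k * x)) (is_derive_scalef k (is_derive_idf x)).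
by apply: (is_derive_eq (is_derive_scalef c H)); rewrite mulr1; ring.
Qed.

Let expc (c k : R) : continuous (fun s : R => c * expR (k * s)).
Proof. by move=> x; exact: (is_derive_cont (expd c k x)). Qed.

(* Measured against the weight exp (2 L x), Picard's operator halves distances,
   so that no smallness of the interval is needed. *)
Let y_step k A i x : 0 <= x ->
  `|y k.+1 A i x - y k A i x| <= 2^-1 ^+ k * expR (2 * L * x).
Proof.
elim: k i x => [|k IH] i x x0.
  rewrite expr0 mul1r.
  apply: le_trans (_ : L * `|x - 0| <= _).
    by have := y_lip 1 A i 0 x; rewrite y0.
  rewrite subr0 ger0_norm//; apply: le_trans (expR_ge1Dx _).
  have : 0 <= L * x by rewrite mulr_ge0// ltW.
  lra.
pose D (s : R) := y k.+2 A i s - y k.+1 A i s.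
have -> : y k.+2 A i x - y k.+1 A i x = D x - D 0 by rewrite /D !y0; ring.
pose h (s : R) : R := 2^-1 ^+ k.+1 * expR (2 * L * s).
apply: (@le_trans _ _ (h x - h 0)); last first.
  by rewrite lerBlDr lerDl mulr_ge0 ?expR_ge0// exprn_ge0// invr_ge0.
apply: (@norm_is_derive_le R _ _ _ _ _ _ x0
  (fun s _ => is_derive_subf (dy k.+1 A i s) (dy k A i s))
  (fun s _ => expd _ (2 * L) s)).
- move=> s /andP[s0 _].
  apply: le_trans (f_lipschitz i s _ _ _ (fun j => IH j s (ltW s0))) _.
  by rewrite exprS le_eqVlt; apply/orP; left; apply/eqP; field.
- apply: continuous_subspaceT => s.
  by apply: continuousB; exact: y_continuous.
- exact/continuous_subspaceT/expc.
Qed.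

Arguments y_step : clear implicits.

Let Y A i x : R := xget 0
  [set l | forall k, `|y k A i x - l| <= 2 * 2^-1 ^+ k * expR (2 * L * x)].

Let YP A i x k : 0 <= x -> `|y k A i x - Y A i x| <= 2 * 2^-1 ^+ k * expR (2 * L * x).
Proof.
move=> x0; have H := xgetPex 0 (geometric_limit (fun k => y_step k A i x x0)).
exact: (H k).
Qed.

Arguments YP : clear implicits.

Let geom0 (C : R) : (fun k => 2 * 2^-1 ^+ k * C) @ \oo --> (0 : R).
Proof.
have -> : 0 = 2 * 0 * C :> R by rewrite mulr0 mul0r.
have H : (fun k => 2^-1 ^+ k : R) @ \oo --> (0 : R).
  by apply: cvg_expr; rewrite ger0_norm ?invr_ge0//; lra.
by apply: cvgM; [apply: cvgM => //; exact: cvg_cst|exact: cvg_cst].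
Qed.

Let y_cvg A i x : 0 <= x -> y k A i x @[k --> \oo] --> Y A i x.
Proof.
move=> x0; apply/cvgrPdist_le => /= e e0.
have : \forall k \near \oo, 2 * 2^-1 ^+ k * expR (2 * L * x) <= e.
  by apply: cvgr_le (geom0 (expR (2 * L * x))) _ e0.
by apply: filterS => k; rewrite distrC; apply/le_trans/YP.
Qed.

Arguments y_cvg : clear implicits.

(** Both the solution and its Lipschitz dependence on the initial value are read
    off Picard's iterates; the derivative of their pointwise limit comes from
    [is_derive_lim].  Components are indexed by an arbitrary type, the norm being
    the supremum. *)
Theorem cauchy_lipschitz : exists Y : (I -> R) -> I -> R -> R,
  [/\ forall A i, Y A i 0 = A i,
      forall A i x, 0 < x -> is_derive x 1 (Y A i) (f i x (Y A ^~ x)),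
      forall A i a b, 0 <= a -> 0 <= b -> `|Y A i b - Y A i a| <= L * `|b - a|
    & forall A B d i x, 0 <= x -> (forall j, `|A j - B j| <= d) ->
        `|Y A i x - Y B i x| <= d * expR (L * x)].
Proof.
exists Y; split.
- move=> A i.
  have H : y k A i 0 @[k --> \oo] --> A i.
    by apply: cvg_near_cst; apply: nearW => k; rewrite y0.
  have H0 := y_cvg A i 0 (lexx 0).
  by rewrite -(cvg_lim _ H)// -(cvg_lim _ H0).
- move=> A i x x0.
  apply: (@is_derive_lim R _ \oo _ (fun k => y k.+1 A i)
    (fun k s => f i s (y k A ^~ s)) _ _ 0 (x + 1)).
  + by rewrite x0 ltrDl ltr01.
  + by move=> n s _; exact: dy.
  + move=> s /andP[s0 _].
    by have := y_cvg A i s (ltW s0); rewrite -(cvg_shiftS (fun k => y k A i s)).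
  + apply/cvgrPdist_le => /= e e0.
    have : \forall k \near \oo, 2 * 2^-1 ^+ k * (L * expR (2 * L * x)) <= e.
      by apply: cvgr_le (geom0 _) _ e0.
    apply: filterS => k; rewrite distrC; apply: le_trans.
    by apply: le_trans (f_lipschitz _ _ _ _ _ (fun j => YP A j x k (ltW x0))) _; lra.
  + move=> e e0.
    have fc := f_continuous i _ (fun j => @cst_continuous R R (Y A j x)).
    have /cvgrPdist_le/(_ (e / 4))[|r r0 Hr] := fc x; first by lra.
    exists (Num.min (r / 2) (e / 4 / (L * L))).
      by rewrite lt_min !divr_gt0// mulr_gt0.
    have : \forall k \near \oo, 2 * 2^-1 ^+ k * (L * expR (2 * L * x)) <= e / 4.
      by apply: cvgr_le (geom0 _) _ _; lra.
    apply: filterS => k Hk s s0; rewrite le_min => /andP[sr sL].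
    have H1 : `|f i s (y k A ^~ s) - f i s (y k A ^~ x)| <= e / 4.
      apply: le_trans (f_lipschitz _ _ _ _ _ (fun j => y_lip k A j x s)) _.
      by rewrite mulrA mulrC -ler_pdivlMr// mulr_gt0.
    have H2 t : `|f i t (y k A ^~ x) - f i t (Y A ^~ x)| <= e / 4.
      apply: le_trans (f_lipschitz _ _ _ _ _ (fun j => YP A j x k (ltW x0))) _.
      by apply: le_trans Hk; lra.
    have H3 : `|f i x (Y A ^~ x) - f i s (Y A ^~ x)| <= e / 4.
      apply: Hr; rewrite /= distrC (le_lt_trans sr)//.
      by rewrite ltr_pdivrMr// ltr_pMr// ltr1n.
    move: H1 H3 (H2 s) (H2 x); rewrite !ler_norml; lra.
- move=> A i a b a0 b0.
  have L1 : `|y k A i b - y k A i a| @[k --> \oo] --> `|Y A i b - Y A i a|.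
    by apply: cvg_norm; apply: cvgB; exact: y_cvg.
  rewrite -(cvg_lim _ L1)//; apply: limr_le; first by apply/cvg_ex; eexists; exact: L1.
  by near=> k; exact: y_lip.
- move=> A B d i x x0 ABd.
  have d0 : 0 <= d by apply: le_trans (ABd i).
  have L1 : `|y k A i x - y k B i x| @[k --> \oo] --> `|Y A i x - Y B i x|.
    by apply: cvg_norm; apply: cvgB; exact: y_cvg.
  rewrite -(cvg_lim _ L1)//; apply: limr_le; first by apply/cvg_ex; eexists; exact: L1.
  near=> k; elim: {+}k i x x0 {L1} => [|n IH] i x x0.
    apply: le_trans (ABd i) _; rewrite ler_peMr//.
    by rewrite -expR0 ler_expR mulr_ge0// ltW.
  pose D (s : R) := y n.+1 A i s - y n.+1 B i s.
  suff : `|D x - D 0| <= d * expR (L * x) - d * expR (L * 0).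
    rewrite mulr0 expR0 mulr1 {2}/D !y0 -/(D x); have := ABd i.
    by rewrite -/(D x) !ler_norml; lra.
  apply: (@norm_is_derive_le R _ _ _ _ _ _ x0
    (fun s _ => is_derive_subf (dy n A i s) (dy n B i s))
    (fun s _ => expd _ L s)).
  + move=> s /andP[s0 _].
    apply: le_trans (f_lipschitz i s _ _ _ (fun j => IH j s (ltW s0))) _.
    by rewrite mulrCA.
  + apply: continuous_subspaceT => s.
    by apply: continuousB; exact: y_continuous.
  + exact/continuous_subspaceT/expc.
Unshelve. all: by end_near. Qed.

End Picard.
End CauchyProblem.

(** * The sublinear nonlinearity and its truncations *)

Section Sublinear.
Context {R : realType}.
Variable p : R.
Hypothesis p01 : 0 < p < 1.
Implicit Types (w x y : R) (n : nat).

Let p0 : 0 < p. Proof. by case/andP: p01. Qed.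

Definition signed_power w := `|w| `^ (p - 1) * w.

(** The signed power has infinite slope at the origin; cutting the modulus by
    the line of slope n makes it n-Lipschitz. *)
Definition truncated_modulus n x := Num.min (n%:R * x) (x `^ p).

Definition truncated_power n w := Num.sg w * truncated_modulus n `|w|.

Let powRSB1 x : 0 <= x -> x `^ p = x `^ (p - 1) * x.
Proof. by move=> x0; rewrite mulrC mulr_powRB1. Qed.

Lemma signed_powerE w : signed_power w = Num.sg w * `|w| `^ p.
Proof.
by rewrite powRSB1// mulrC /signed_power -mulrA (mulrC `|w|) -numEsg.
Qed.

Let powR_mono x y : 0 <= x -> x <= y -> x `^ p <= y `^ p.
Proof.
move=> x0 xy; apply: ge0_ler_powR => //; rewrite ?nnegrE//; first exact: ltW.
exact: le_trans xy.
Qed.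

Let powR_decr x y : 0 < x -> x <= y -> y `^ (p - 1) <= x `^ (p - 1).
Proof.
move=> x0 xy; have y0 := lt_le_trans x0 xy.
rewrite -(opprB 1) !powRN lef_pV2 ?posrE ?powR_gt0//.
apply: ge0_ler_powR => //; rewrite ?nnegrE; [|exact: ltW|exact: ltW].
by rewrite subr_ge0 ltW//; case/andP: p01.
Qed.

Let modulus_ge0 n x : 0 <= x -> 0 <= truncated_modulus n x.
Proof. by move=> x0; rewrite /truncated_modulus le_min powR_ge0 mulr_ge0. Qed.

Let modulus_le n x y : 0 <= x -> x <= y ->
  truncated_modulus n x <= truncated_modulus n y.
Proof.
move=> x0 xy; rewrite /truncated_modulus le_min !ge_min; apply/andP; split.
  by rewrite ler_wpM2l.
by apply/orP; right; exact: powR_mono.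
Qed.

Let modulus_lip n x y : 0 <= x -> x <= y ->
  truncated_modulus n y - truncated_modulus n x <= n%:R * (y - x).
Proof.
move=> x0 xy; rewrite lerBlDl.
rewrite {2}/truncated_modulus; case: (leP (n%:R * x) (x `^ p)) => nx.
  by rewrite /truncated_modulus ge_min; apply/orP; left; lra.
have xp : 0 < x.
  by rewrite lt_neqAle x0 andbT; apply: contraTN nx => /eqP<-; rewrite mulr0 powR0 ?gt_eqF// ltxx.
rewrite /truncated_modulus ge_min; apply/orP; right.
rewrite !powRSB1 ?(le_trans x0)//.
have H1 := powR_decr xp xy.
have H2 : x `^ (p - 1) < n%:R by rewrite -(ltr_pM2r xp) -powRSB1.
apply: le_trans (_ : x `^ (p - 1) * y <= _).
  by apply: ler_wpM2r => //; exact: le_trans xy.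
have : x `^ (p - 1) * (y - x) <= n%:R * (y - x).
  by rewrite ler_wpM2r ?subr_ge0// ltW.
lra.
Qed.

Lemma truncated_power0 n : truncated_power n 0 = 0.
Proof. by rewrite /truncated_power sgr0 mul0r. Qed.

Lemma truncated_powerN n w : truncated_power n (- w) = - truncated_power n w.
Proof. by rewrite /truncated_power sgrN normrN mulNr. Qed.

Let truncated_power_pos n w : 0 <= w -> truncated_power n w = truncated_modulus n w.
Proof.
rewrite le_eqVlt => /predU1P[<-|w0].
  by rewrite truncated_power0 /truncated_modulus mulr0 powR0 ?gt_eqF// minxx.
by rewrite /truncated_power gtr0_sg// mul1r gtr0_norm.
Qed.

Lemma truncated_power_lipschitz n w x :
  `|truncated_power n w - truncated_power n x| <= n%:R * `|w - x|.
Proof.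
(* By symmetry x <= w; oddness then leaves arguments of equal or opposite signs. *)
have pos a b : 0 <= b -> b <= a ->
    `|truncated_power n a - truncated_power n b| <= n%:R * `|a - b|.
  move=> b0 ba; rewrite !truncated_power_pos ?(le_trans b0)//.
  rewrite !ger0_norm ?subr_ge0 ?modulus_le//; exact: modulus_lip.
have opp a b : 0 <= a -> 0 <= b ->
    `|truncated_power n a - truncated_power n (- b)| <= n%:R * `|a - - b|.
  move=> a0 b0; rewrite truncated_powerN !opprK !truncated_power_pos//.
  rewrite !ger0_norm ?addr_ge0 ?modulus_ge0// mulrDr lerD// /truncated_modulus ge_min lexx//.
wlog xw : w x / x <= w.
  move=> H; case: (leP x w) => [/H//|/ltW/H].
  by rewrite distrC (distrC x).
case: (leP 0 x) => [x0|x0]; first exact: pos.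
case: (leP 0 w) => [w0|w0].
  by rewrite -[x]opprK; apply: opp => //; rewrite oppr_ge0 ltW.
have := pos (- x) (- w); rewrite !truncated_powerN.
have -> : - truncated_power n x - - truncated_power n w =
  truncated_power n w - truncated_power n x by rewrite opprK addrC.
rewrite opprK [- x + w]addrC; apply; first by rewrite oppr_ge0 ltW.
by rewrite lerN2.
Qed.

Lemma mul_truncated_power n w :
  w * truncated_power n w = `|w| * truncated_modulus n `|w|.
Proof. by rewrite /truncated_power mulrA [w * _]mulrC -normrEsg. Qed.

Lemma mul_truncated_power_ge0 n w : 0 <= w * truncated_power n w.
Proof. by rewrite mul_truncated_power mulr_ge0// modulus_ge0. Qed.

Lemma norm_truncated_power_le n w : `|truncated_power n w| <= `|w| + 1.
Proof.
rewrite /truncated_power normrM.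
apply: le_trans (_ : 1 * truncated_modulus n `|w| <= _).
  rewrite [`|truncated_modulus _ _|]ger0_norm ?modulus_ge0// ler_wpM2r ?modulus_ge0//.
  by rewrite normr_sg; case: (w == 0).
rewrite mul1r /truncated_modulus ge_min; apply/orP; right.
case: (leP `|w| 1) => w1.
  have := powR_mono (normr_ge0 w) w1; rewrite powR1.
  by have := normr_ge0 w; lra.
by apply: le_trans (ler1_powR _ _) _; rewrite ?lerDl// ltW//; case/andP: p01.
Qed.

(** Since p < 1, |w|^(p-1) is unbounded near the origin, and the slope of the
    truncation is the smaller of it and n. *)
Lemma truncated_power_steep (K : R) : 0 < K -> exists2 a : R, 0 < a &
  forall n w, K <= n%:R -> `|w| <= a -> K * w ^+ 2 <= w * truncated_power n w.
Proof.
move=> K0; exists (K `^ (p - 1)^-1); first exact: powR_gt0.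
move=> n w Kn wa; rewrite mul_truncated_power -(real_normK (num_real w)) expr2 mulrCA ler_wpM2l//.
have [->|w0] := eqVneq `|w| 0.
  by rewrite mulr0 modulus_ge0.
have {}w0 : 0 < `|w| by rewrite lt_neqAle eq_sym w0/=.
rewrite /truncated_modulus le_min ler_wpM2r//= powRSB1// ler_wpM2r//.
apply: le_trans (powR_decr w0 wa).
have p10 : p - 1 != 0 by rewrite subr_eq0 lt_eqF//; case/andP: p01.
by rewrite -powRrM mulVf// powRr1// ltW.
Qed.

(** Truncation changes the value only where |w|^(p-1) > n, hence for small w, and
    there both functions are small. *)
Lemma truncated_power_approx (e : R) : 0 < e -> exists2 n0 : R, 0 <= n0 &
  forall n w, n0 <= n%:R -> `|truncated_power n w - signed_power w| <= e.
Proof.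
move=> e0; pose b := e `^ p^-1; exists (b `^ (p - 1) + 1).
  by rewrite addr_ge0 ?powR_ge0.
move=> n w nn; rewrite signed_powerE /truncated_power -mulrBr normrM.
rewrite /truncated_modulus; case: (leP (n%:R * `|w|) (`|w| `^ p)) => H; last first.
  by rewrite subrr normr0 mulr0 ltW.
apply: le_trans (_ : 1 * `|w| `^ p <= _).
  apply: ler_pM => //; first by rewrite normr_sg; case: (w == 0).
  rewrite distrC ger0_norm ?subr_ge0// gerBl mulr_ge0//.
rewrite mul1r leNgt; apply/negP => ew.
have bw : b < `|w|.
  rewrite ltNge; apply/negP => wb; move: ew; rewrite ltNge => /negP; apply.
  have -> : e = b `^ p by rewrite -powRrM mulVf ?gt_eqF// powRr1// ltW.
  by apply: powR_mono.
have w0 : 0 < `|w| by apply: le_lt_trans bw; exact: powR_ge0.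
have : n%:R <= `|w| `^ (p - 1) by rewrite -(ler_pM2r w0) -powRSB1.
have b0 : 0 < b by exact: powR_gt0.
have := powR_decr b0 (ltW bw).
lra.
Qed.

Lemma signed_power_continuous : continuous signed_power.
Proof.
move=> x; apply/cvgrPdist_le => /= e e0.
have [|n0 _ H] := @truncated_power_approx (e / 4); first by lra.
pose n := (Num.truncn n0).+1.
have nn : n0 <= n%:R by rewrite ltW// truncnS_gt.
have nr : 0 < n%:R :> R by rewrite ltr0n.
near=> y.
have H1 := H n x nn; have H2 := H n y nn.
have H3 : `|truncated_power n x - truncated_power n y| <= e / 4.
  apply: le_trans (truncated_power_lipschitz _ _ _) _.
  rewrite mulrC -ler_pdivlMr//; near: y.
  by apply: cvgr_dist_le => //; rewrite !divr_gt0.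
move: H1 H2 H3; rewrite !ler_norml; lra.
Unshelve. all: by end_near. Qed.

Variable mu : R.
Hypothesis mu0 : 0 < mu.

Definition truncated_force n w := mu * w + truncated_power n w.

Lemma norm_truncated_force_le n w : `|truncated_force n w| <= (mu + 1) * `|w| + 1.
Proof.
apply: le_trans (ler_normD _ _) _; rewrite normrM (gtr0_norm mu0).
have := norm_truncated_power_le n w; lra.
Qed.

Lemma truncated_force_lipschitz n w v :
  `|truncated_force n w - truncated_force n v| <= (mu + n%:R) * `|w - v|.
Proof.
have -> : truncated_force n w - truncated_force n v =
  mu * (w - v) + (truncated_power n w - truncated_power n v).
  by rewrite /truncated_force; ring.
apply: le_trans (ler_normD _ _) _; rewrite normrM (gtr0_norm mu0) mulrDl lerD//.
exact: truncated_power_lipschitz.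
Qed.

(** The two quadratic bounds do not depend on the truncation, which is what makes
    the energy estimates below uniform. *)
Lemma truncated_potential n : exists G : R -> R,
  [/\ forall w, is_derive w 1 G (truncated_force n w),
      forall w : R, mu / 2 * w ^+ 2 <= G w
    & forall w : R, G w <= `|w| * ((mu + 1) * `|w| + 1)].
Proof.
have cf : continuous (truncated_force n).
  have n1 : 0 < mu + n%:R by apply: ltr_wpDr.
  move=> w; apply/cvgrPdist_le => /= e e0; near=> z.
  apply: le_trans (truncated_force_lipschitz n w z) _.
  rewrite mulrC -ler_pdivlMr//; near: z.
  by apply: cvgr_dist_le; [exact: cvg_id|exact: divr_gt0].
have [G [G0 dG]] := antiderivative cf; exists G; split => // w.
- have sgn (s : R) : 0 <= s * truncated_power n s := mul_truncated_power_ge0 n s.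
  pose H (s : R) := G s - mu / 2 * (s * s).
  have dH (s : R) : is_derive s 1 H (truncated_power n s).
    have d2 := is_derive_mulf (is_derive_idf s) (is_derive_idf s).
    apply: (is_derive_eq (is_derive_subf (dG s) (is_derive_scalef (mu / 2) d2))).
    rewrite /truncated_force; lra.
  have cH : continuous H by move=> s; exact: (is_derive_cont (dH s)).
  suff : H 0 <= H w by rewrite /H G0 expr2; lra.
  case: (leP 0 w) => w0.
    apply: (@ge0_is_derive_le R H _ 0 w w0 (fun s _ => dH s)).
      by move=> s /andP[s0 _]; rewrite -(pmulr_rge0 _ s0).
    exact: continuous_subspaceT.
  rewrite -lerN2.
  apply: (@ge0_is_derive_le R (fun s => - H s) _ w 0 (ltW w0)
    (fun s _ => is_derive_oppf (dH s))).
    move=> s /andP[_ s0]; rewrite oppr_ge0 -(nmulr_rge0 _ s0); exact: sgn.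
  by apply: continuous_subspaceT => s; apply: continuousN; exact: cH.
- have cG : continuous G by move=> s; exact: (is_derive_cont (dG s)).
  have gle (s : R) : `|s| <= `|w| -> `|truncated_force n s| <= (mu + 1) * `|w| + 1.
    move=> sw; apply: le_trans (norm_truncated_force_le _ _) _.
    by rewrite lerD2r ler_wpM2l// addr_ge0// ltW.
  set K := (mu + 1) * `|w| + 1 in gle *; rewrite mulrC.
  case: (leP 0 w) => w0.
    have : `|G w - G 0| <= K * (w - 0).
      apply: (lipschitz_is_derive w0 (fun s _ => dG s)).
        by move=> s /andP[s0 sw]; apply: gle; rewrite !ger0_norm ?(ltW s0) ?(ltW sw).
      exact: continuous_subspaceT.
    by rewrite G0 !subr0 (ger0_norm w0); apply: le_trans; exact: ler_norm.
  have : `|G 0 - G w| <= K * (0 - w).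
    apply: (lipschitz_is_derive (ltW w0) (fun s _ => dG s)).
      by move=> s /andP[sw s0]; apply: gle; rewrite !ltr0_norm ?lerN2 ?(ltW sw).
    exact: continuous_subspaceT.
  rewrite G0 !sub0r normrN (ltr0_norm w0); apply: le_trans; exact: ler_norm.
Unshelve. all: by end_near. Qed.

End Sublinear.

(** * Polar coordinates in the phase plane *)

Section Prufer.
Context {R : realType}.
Implicit Types (th l x s d c b : R).

Lemma norm_mulB_le (a b a' b' A B da db : R) :
  `|a| <= A -> `|b'| <= B -> `|a - a'| <= da -> `|b - b'| <= db ->
  `|a * b - a' * b'| <= A * db + da * B.
Proof.
move=> aA bB Ha Hb.
have -> : a * b - a' * b' = a * (b - b') + (a - a') * b' by ring.
by apply: le_trans (ler_normD _ _) _; rewrite !normrM lerD// ler_pM.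
Qed.

Lemma norm_sin_le1 s : `|sin s| <= 1.
Proof. by rewrite ler_norml sin_geN1 sin_le1. Qed.

Lemma norm_cos_le1 s : `|cos s| <= 1.
Proof. by rewrite ler_norml cos_geN1 cos_le1. Qed.

Section PolarForce.
Variables (g : R -> R) (K : R).
Hypothesis K0 : 0 <= K.
Hypothesis g_lip : forall s t, `|g s - g t| <= K * `|s - t|.
Hypothesis g0 : g 0 = 0.

(** Dividing the force by the radius exp l in the coordinates w = exp l * sin th
    keeps it Lipschitz in the logarithmic radius l, however small the radius. *)
Definition polar_force th l := expR (- l) * g (expR l * sin th).

Let g_le s : `|g s| <= K * `|s|.
Proof. by have := g_lip s 0; rewrite g0 !subr0. Qed.

Lemma norm_polar_force_le th l : `|polar_force th l| <= K.
Proof.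
rewrite normrM gtr0_norm ?expR_gt0// expRN mulrC ler_pdivrMr ?expR_gt0//.
apply: le_trans (g_le _) _; rewrite normrM gtr0_norm ?expR_gt0//.
by rewrite ler_wpM2l// ler_piMr ?expR_ge0// norm_sin_le1.
Qed.

Lemma polar_force_lipschitz th th' l l' d :
  `|th - th'| <= d -> `|l - l'| <= d ->
  `|polar_force th l - polar_force th' l'| <= 3 * K * d.
Proof.
move=> thd ld.
have H1 : `|polar_force th l - polar_force th' l| <= K * d.
  rewrite /polar_force -mulrBr normrM gtr0_norm ?expR_gt0// expRN mulrC.
  rewrite ler_pdivrMr ?expR_gt0//; apply: le_trans (g_lip _ _) _.
  rewrite -mulrBr normrM gtr0_norm ?expR_gt0// -mulrA ler_wpM2l//.
  by rewrite mulrC ler_wpM2r ?expR_ge0//; exact: le_trans (norm_sinB _ _) _.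
suff H2 : `|polar_force th' l - polar_force th' l'| <= 2 * K * d.
  apply: le_trans (ler_distD (polar_force th' l) _ _) _; lra.
wlog ll' : l l' ld {H1} / l <= l'.
  move=> H; have [ll|/ltW ll] := leP l l'; first exact: H.
  by rewrite distrC; apply: H => //; rewrite distrC.
rewrite /polar_force; set s := sin th'.
have s1 : `|s| <= 1 by exact: norm_sin_le1.
have e1 : expR (- l) * expR l = 1 by rewrite -expRD addNr expR0.
have e2 : expR (- l') * expR l' = 1 by rewrite -expRD addNr expR0.
have e3 : expR (- l') <= expR (- l) by rewrite ler_expR lerN2.
have e4 : expR l <= expR l' by rewrite ler_expR.
have e5 : 1 - d <= expR (- l') * expR l.
  rewrite -expRD; apply: le_trans (expR_ge1Dx _).
  by move: ld; rewrite ler_norml; lra.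
have -> : expR (- l) * g (expR l * s) - expR (- l') * g (expR l' * s) =
  (expR (- l) - expR (- l')) * g (expR l * s) +
  expR (- l') * (g (expR l * s) - g (expR l' * s)) by ring.
apply: le_trans (ler_normD _ _) _.
have -> : 2 * K * d = K * d + K * d by ring.
rewrite !normrM (ger0_norm (expR_ge0 (- l'))) ger0_norm ?subr_ge0//; apply: lerD.
- apply: le_trans (_ : (expR (- l) - expR (- l')) * (K * expR l) <= _).
    rewrite ler_wpM2l ?subr_ge0//; apply: le_trans (g_le _) _.
    by rewrite normrM (ger0_norm (expR_ge0 l)) ler_wpM2l// ler_piMr ?expR_ge0.
  rewrite mulrCA ler_wpM2l// mulrBl e1; lra.
- apply: le_trans (_ : expR (- l') * (K * (expR l' - expR l)) <= _).
    rewrite ler_wpM2l ?expR_ge0//; apply: le_trans (g_lip _ _) _.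
    rewrite -mulrBl normrM distrC (@ger0_norm _ (_ - _)) ?subr_ge0// ler_wpM2l//.
    by rewrite ler_piMr ?subr_ge0.
  rewrite mulrCA ler_wpM2l// mulrBr e2; lra.
Qed.

Lemma polar_force_continuous (th l : R -> R) : continuous th -> continuous l ->
  continuous (fun s => polar_force (th s) (l s)).
Proof.
move=> cth cl x; apply/cvgrPdist_le => /= e e0.
have r0 : 0 < e / (3 * K + 1) by rewrite divr_gt0// ltr_wpDl ?mulr_ge0.
near=> y.
apply: le_trans (_ : 3 * K * (e / (3 * K + 1)) <= _).
  apply: polar_force_lipschitz; near: y.
    by have /cvgrPdist_le := cth x; apply.
  by have /cvgrPdist_le := cl x; apply.
have rE : (3 * K + 1) * (e / (3 * K + 1)) = e.
  by rewrite mulrC divfK// gt_eqF// ltr_wpDl ?mulr_ge0.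
apply: (@le_trans _ _ ((3 * K + 1) * (e / (3 * K + 1)))); last by rewrite rE.
by rewrite [leRHS]mulrDl mul1r lerDl ltW.
Unshelve. all: by end_near. Qed.

Variables (al be : R -> R) (M : R).
Hypothesis M0 : 0 < M.
Hypothesis al_continuous : continuous al.
Hypothesis be_continuous : continuous be.
Hypothesis al_le : forall x, `|al x| <= M.
Hypothesis be_le : forall x, `|be x| <= M.

Let field (i : bool) x (y : bool -> R) : R :=
  if i then sin (y false) * cos (y false) * al x -
            be x * (cos (y false) * polar_force (y false) (y true))
  else al x * cos (y false) ^+ 2 +
       be x * (sin (y false) * polar_force (y false) (y true)).

Let L : R := 2 * M + 4 * (M * K).

Let MK : 0 <= M * K. Proof. by rewrite mulr_ge0// ltW. Qed.

Let field_le i x y : `|field i x y| <= L.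
Proof.
have sc (t : R) : `|sin t * cos t| <= 1.
  by rewrite normrM mulr_ile1 ?norm_sin_le1 ?norm_cos_le1.
have cc (t : R) : `|cos t ^+ 2| <= 1.
  by rewrite normrX exprn_ile1// norm_cos_le1.
have q1 := norm_polar_force_le (y false) (y true).
have H (t : R) : `|t| <= 1 -> `|be x * (t * polar_force (y false) (y true))| <= M * K.
  move=> t1; rewrite 2!normrM; apply: ler_pM => //.
  by rewrite -[leRHS]mul1r; apply: ler_pM.
apply: (@le_trans _ _ (M + M * K)); last by move: MK M0; rewrite /L; lra.
case: i => /=; apply: le_trans (ler_normD _ _) _; rewrite ?normrN lerD//.
- by rewrite normrM -[leRHS]mul1r ler_pM.
- exact/H/norm_cos_le1.
- by rewrite normrM -[leRHS]mulr1 ler_pM.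
- exact/H/norm_sin_le1.
Qed.

Let field_lip i x (y z : bool -> R) d : (forall j, `|y j - z j| <= d) ->
  `|field i x y - field i x z| <= L * d.
Proof.
move=> yz; have d0 : 0 <= d := le_trans (normr_ge0 _) (yz true).
have q1 := norm_polar_force_le (z false) (z true).
have q2 := polar_force_lipschitz (yz false) (yz true).
have s2 := le_trans (norm_sinB _ _) (yz false).
have c2 := le_trans (norm_cosB _ _) (yz false).
have H (t t' : R) : `|t| <= 1 -> `|t - t'| <= d ->
    `|be x * (t * polar_force (y false) (y true)) -
      be x * (t' * polar_force (z false) (z true))| <= M * (4 * K * d).
  move=> t1 td; rewrite -mulrBr normrM ler_pM//.
  apply: le_trans (norm_mulB_le t1 q1 td q2) _; lra.
have -> : L * d = M * (2 * d) + M * (4 * K * d) by rewrite /L; ring.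
case: i => /=.
- have -> : forall A B C D : R, A - B - (C - D) = (A - C) - (B - D) by move=> *; ring.
  apply: le_trans (ler_normB _ _) _; apply: lerD.
    rewrite -mulrBl normrM mulrC ler_pM//.
    by apply: le_trans (norm_mulB_le _ _ s2 c2) _; [exact: norm_sin_le1|exact: norm_cos_le1|lra].
  by apply: H => //; exact: norm_cos_le1.
- have -> : forall A B C D : R, A + B - (C + D) = (A - C) + (B - D) by move=> *; ring.
  apply: le_trans (ler_normD _ _) _; apply: lerD.
    rewrite -mulrBr normrM ler_pM// !expr2.
    by apply: le_trans (norm_mulB_le _ _ c2 c2) _; [exact: norm_cos_le1|exact: norm_cos_le1|lra].
  by apply: H => //; exact: norm_sin_le1.
Qed.

Let field_cont i (y : bool -> R -> R) : (forall j, continuous (y j)) ->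
  continuous (fun s : R => field i s (y ^~ s)).
Proof.
  move=> cy.
  have cs : continuous (fun s => sin (y false s)).
    by move=> s; apply: (@continuous_comp _ _ _ (y false) sin); [exact: cy|exact: continuous_sin].
  have cc' : continuous (fun s => cos (y false s)).
    by move=> s; apply: (@continuous_comp _ _ _ (y false) cos); [exact: cy|exact: continuous_cos].
  have cq := polar_force_continuous (cy false) (cy true).
  case: i => s /=.
  - apply: cvgB; apply: cvgM; [|exact: al_continuous|exact: be_continuous|].
      by apply: cvgM; [exact: cs|exact: cc'].
    by apply: cvgM; [exact: cc'|exact: cq].
  - apply: cvgD; apply: cvgM; [exact: al_continuous| |exact: be_continuous|].
      by rewrite expr2; apply: cvgM; exact: cc'.
    by apply: cvgM; [exact: cs|exact: cq].
Qed.

(** In the coordinates w = exp l * sin th, v = exp l * cos th the system w' = al v,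
    v' = - be g(w) has a globally Lipschitz right-hand side: the origin is sent to
    infinity, and the angle, being part of the solution, depends continuously on
    the initial radius without any lifting argument. *)
Theorem prufer_flow th0 : exists th l : R -> R -> R,
  [/\ (forall c, th c 0 = th0) /\ (forall c, l c 0 = c),
      forall c x, 0 < x -> is_derive x 1 (th c)
        (al x * cos (th c x) ^+ 2 +
         be x * (sin (th c x) * polar_force (th c x) (l c x))),
      forall c x, 0 < x -> is_derive x 1 (l c)
        (sin (th c x) * cos (th c x) * al x -
         be x * (cos (th c x) * polar_force (th c x) (l c x))),
      forall c b, {within `[0, b], continuous (th c)} /\
                  {within `[0, b], continuous (l c)}
    & forall x, 0 <= x -> continuous (th ^~ x)].
Proof.
have L0 : 0 < L by move: MK M0; rewrite /L; lra.
have [Y [Y0 dY Ylip Ydep]] := cauchy_lipschitz L0 field_le field_lip field_cont.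
pose A c (i : bool) : R := if i then c else th0.
have Yc c b i : {within `[0, b], continuous (Y (A c) i)}.
  apply: (continuous_within_lipschitz L0) => x z /=.
  by rewrite !in_itv/= => /andP[x0 _] /andP[z0 _]; exact: Ylip.
exists (fun c => Y (A c) false), (fun c => Y (A c) true); split.
- by split=> c; rewrite Y0.
- by move=> c x x0; exact: dY.
- by move=> c x x0; exact: dY.
- by move=> c b; split; exact: Yc.
- move=> x x0 c; apply/cvgrPdist_le => /= e e0; near=> c'.
  apply: le_trans (Ydep _ _ `|c - c'| _ _ x0 _) _.
    by case=> //=; rewrite subrr normr0.
  rewrite -ler_pdivlMr ?expR_gt0//; near: c'.
  by apply: cvgr_dist_le => //; rewrite divr_gt0// expR_gt0.
Unshelve. all: by end_near. Qed.

End PolarForce.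

(** The function th + atan ((k-1) sin th cos th / (cos^2 th + k sin^2 th)) is a
    continuous determination of the angle after one axis has been rescaled by
    the factor k.  It stays within pi/2 of th, and its derivative
    k / (cos^2 th + k^2 sin^2 th) turns the assumption on the speed of th into a
    lower bound c k for that of the rescaled angle. *)
Lemma rotation_ge (th dth : R -> R) (c k b : R) : 0 <= c -> 1 <= k -> 0 <= b ->
  (forall x, 0 < x < b -> is_derive x 1 th (dth x)) ->
  {within `[0, b], continuous th} ->
  (forall x, 0 < x < b -> c * (cos (th x) ^+ 2 + k ^+ 2 * sin (th x) ^+ 2) <= dth x) ->
  c * k * b - pi <= th b - th 0.
Proof.
move=> c0 k1 b0 dthP cth Hth.
have k0 : 0 < k by lra.
have D0 t : 0 < cos t ^+ 2 + k * sin t ^+ 2.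
  have := cos2Dsin2 t; have := sqr_ge0 (sin t); have : 0 <= (k - 1) * sin t ^+ 2.
    by rewrite mulr_ge0 ?sqr_ge0// subr_ge0.
  lra.
have E0 t : 0 < cos t ^+ 2 + k ^+ 2 * sin t ^+ 2.
  have := cos2Dsin2 t; have : 0 <= (k ^+ 2 - 1) * sin t ^+ 2.
    by rewrite mulr_ge0 ?sqr_ge0// subr_ge0 exprn_ege1.
  lra.
pose u t := (k - 1) * (sin t * cos t) / (cos t ^+ 2 + k * sin t ^+ 2).
pose G t := t + atan (u t).
have dG (t : R) : is_derive t 1 G (k / (cos t ^+ 2 + k ^+ 2 * sin t ^+ 2)).
  have ds2 := is_derive_mulf (is_derive_sin t) (is_derive_sin t).
  have dc2 := is_derive_mulf (is_derive_cos t) (is_derive_cos t).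
  have dsc := is_derive_mulf (is_derive_sin t) (is_derive_cos t).
  have dN := is_derive_scalef (k - 1) dsc.
  have dD := is_derive_addf dc2 (is_derive_scalef k ds2).
  have D0' : cos t * cos t + k * (sin t * sin t) != 0.
    by have := D0 t; rewrite !expr2 => /gt_eqF->.
  have dQ := is_derive_mulf dN (@is_derive_invf R (fun y => cos y * cos y + k * (sin y * sin y)) t _ D0' dD).
  have uE : (fun y : R => (k - 1) * (sin y * cos y) * (cos y * cos y + k * (sin y * sin y))^-1) = u.
    by apply/funext => y; rewrite /u !expr2.
  rewrite uE in dQ.
  apply: (is_derive_eq (is_derive_addf (is_derive_idf t)
    (is_derive_compf (is_derive1_atan (u t)) dQ))).
  rewrite /u; have := cos2Dsin2 t; move: (D0 t) (E0 t) D0'.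
  move: (cos t) (sin t) => C S D0'' E0' D' cs.
  set D := C ^+ 2 + k * S ^+ 2 in D0'' D' *; set E := C ^+ 2 + k ^+ 2 * S ^+ 2 in E0' *.
  have Dn : D != 0 by rewrite gt_eqF.
  have En : E != 0 by rewrite gt_eqF.
  (* 1 + u^2 = E / D^2, by the Pythagorean identity *)
  have key : D ^+ 2 + ((k - 1) * (S * C)) ^+ 2 = E.
    have -> : D ^+ 2 + ((k - 1) * (S * C)) ^+ 2 = E * (C ^+ 2 + S ^+ 2).
      by rewrite /D /E; ring.
    by rewrite cs mulr1.
  have -> : (1 + ((k - 1) * (S * C) / D) ^+ 2)^-1 = D ^+ 2 / E.
    by rewrite -key; field; rewrite key Dn En.
  pose N' := (k - 1) * (C * C + S * - S); pose DD := - S * C + C * - S + k * (C * S + S * C).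
  rewrite -/N' -/DD.
  have -> : 1 + D ^+ 2 / E * (N' * D^-1 + (k - 1) * (S * C) * (- DD / D ^+ 2)) =
    (E + (N' * D - (k - 1) * (S * C) * DD)) / E by field; rewrite ?Dn ?En.
  congr (_ / _).
  have -> : E + (N' * D - (k - 1) * (S * C) * DD) = k * (C ^+ 2 + S ^+ 2) +
    (k - 1) * (C ^+ 2 - k * S ^+ 2) * (C ^+ 2 + S ^+ 2 - 1).
    rewrite /E /N' /D /DD; ring.
  by rewrite cs subrr mulr0 addr0 mulr1.
have GE t : `|G t - t| <= pi / 2.
  rewrite /G addrC addKr ler_norml; apply/andP; split; last exact/ltW/atan_ltpi2.
  exact/ltW/atan_gtNpi2.
have cG : continuous G by move=> t; exact: (is_derive_cont (dG t)).
have : - (c * k * 0) + G (th 0) <= - (c * k * b) + G (th b).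
  have dl (x : R) : is_derive x 1 (fun y => - (c * k * y)) (- (c * k * 1)).
    exact: (is_derive_oppf (is_derive_scalef (c * k) (is_derive_idf x))).
  apply: (@ge0_is_derive_le R (fun x => - (c * k * x) + G (th x)) _ 0 b b0
    (fun x xb => is_derive_addf (dl x) (is_derive_compf (dG (th x)) (dthP x xb)))).
    move=> x /Hth Hx; rewrite mulr1 addrC subr_ge0 mulrAC ler_pdivlMr//.
    by rewrite mulrAC mulrC ler_wpM2l// ltW.
  have c1 : {within `[0, b], continuous (fun y => - (c * k * y))}.
    by apply: continuous_subspaceT => y; exact: (is_derive_cont (dl y)).
  have c2 : {within `[0, b], continuous (fun y => G (th y))}.
    move=> y; exact: (@continuous_comp (subspace `[0, b]%classic) R R th G y (cth y) (cG (th y))).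
  by move=> x; exact: (continuousD (c1 x) (c2 x)).
move: (GE (th b)) (GE (th 0)); rewrite !ler_norml; lra.
Qed.

(** Multiplication by exp (C x) makes f nondecreasing, by exp (- C x)
    nonincreasing. *)
Lemma gronwall (f df : R -> R) (C b : R) : 0 <= b ->
  (forall x, 0 < x < b -> is_derive x 1 f (df x)) ->
  {within `[0, b], continuous f} ->
  (forall x, 0 < x < b -> `|df x| <= C * f x) ->
  f b <= f 0 * expR (C * b) /\ f 0 <= f b * expR (C * b).
Proof.
move=> b0 dfP cf Hf.
have de (k x : R) : is_derive x 1 (fun s => expR (k * s)) (expR (k * x) * k).
  apply: (is_derive_eq (is_derive_compf (is_derive_expR (k * x))
    (is_derive_scalef k (is_derive_idf x)))).
  by rewrite mulr1.
have ce (k : R) : {within `[0, b], continuous (fun s => expR (k * s))}.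
  by apply: continuous_subspaceT => x; exact: (is_derive_cont (de k x)).
have H1 : f 0 * expR (C * 0) <= f b * expR (C * b).
  apply: (@ge0_is_derive_le R (fun x => f x * expR (C * x)) _ 0 b b0
    (fun x xb => is_derive_mulf (dfP x xb) (de C x))).
    move=> x /Hf; rewrite ler_norml => /andP[h _].
    have -> : df x * expR (C * x) + f x * (expR (C * x) * C) =
      (df x + C * f x) * expR (C * x) by ring.
    by rewrite mulr_ge0 ?expR_ge0//; lra.
  by move=> x; exact: (continuousM (cf x) (ce C x)).
have H2 : - (f 0 * expR (- C * 0)) <= - (f b * expR (- C * b)).
  apply: (@ge0_is_derive_le R (fun x => - (f x * expR (- C * x))) _ 0 b b0
    (fun x xb => is_derive_oppf (is_derive_mulf (dfP x xb) (de (- C) x)))).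
    move=> x /Hf; rewrite ler_norml => /andP[_ h].
    have -> : - (df x * expR (- C * x) + f x * (expR (- C * x) * - C)) =
      (C * f x - df x) * expR (- C * x) by ring.
    by rewrite mulr_ge0 ?expR_ge0//; lra.
  by move=> x; exact: (continuousN (continuousM (cf x) (ce (- C) x))).
split; last by move: H1; rewrite mulr0 expR0 mulr1.
move: H2; rewrite mulr0 expR0 mulr1 lerN2 mulNr expRN.
by rewrite ler_pdivrMr ?expR_gt0.
Qed.

End Prufer.

(** * Shooting for stationary solutions *)

(** The linear combination changes sign when the angle increases by pi. *)
Lemma zero_on_half_turn {R : realType} (A B t0 : R) :
  exists2 t, t0 <= t <= t0 + pi & A * sin t + B * cos t = 0.
Proof.
pose f (t : R) := A * sin t + B * cos t.
have cf : {within `[t0, t0 + pi], continuous f}.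
  apply: continuous_subspaceT => t.
  by apply: cvgD; apply: cvgMl_tmp; [exact: continuous_sin|exact: continuous_cos].
have t0pi : t0 <= t0 + pi by rewrite lerDl pi_ge0.
have fE : f (t0 + pi) = - f t0 by rewrite /f sinDpi cosDpi; lra.
have [|t tI ft] := IVT (v := 0) t0pi cf.
  rewrite fE ge_min le_max; case: (leP 0 (f t0)) => [h|/ltW h].
    by rewrite oppr_le0 h orbT.
  by rewrite oppr_ge0 h orbT.
by exists t => //; move: tI; rewrite in_itv.
Qed.

(** The limit is the supremum of the lower bounds that hold on a member of the
    ultrafilter: any number above it fails to be one, hence is an upper bound on
    another member. *)
Lemma ultra_cvg_bounded {R : realType} (T : Type) (F : set_system T)
    (u : T -> R) (M : R) : UltraFilter F -> (forall n, `|u n| <= M) ->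
  exists l : R, u n @[n --> F] --> l.
Proof.
move=> FU uM.
pose S : set R := [set q | F [set n | q <= u n]].
have FT : F setT by exact: filterT.
have S0 : S (- M).
  by apply: filterS FT => n _ /=; have := uM n; rewrite ler_norml => /andP[].
have SM : ubound S M.
  move=> q Sq; have [n /= qn] := filter_ex Sq; apply: le_trans qn _.
  exact: le_trans (ler_norm _) (uM n).
have supS : has_sup S by split; [exists (- M)|exists M].
exists (sup S); apply/cvgrPdist_lt => /= e e0.
have [q Sq lq] := sup_adherent e0 supS.
have up : F [set n | u n < sup S + e].
  have [//|H] := in_ultra_setVsetC [set n | u n < sup S + e] FU.
  have : S (sup S + e) by apply: filterS H => n /= /negP; rewrite -leNgt.
  by move=> /(sup_upper_bound supS); rewrite gerDl leNgt e0.
apply: filterS2 Sq up => n /= qn un.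
by rewrite ltr_norml; lra.
Qed.

Section Shooting.
Context {R : realType}.
Variables (rho drho : R -> R) (b : R).
Hypothesis b0 : 0 < b.
Hypothesis rho_cont : {within `[0, b], continuous rho}.
Hypothesis drho_cont : {within `[0, b], continuous drho}.
Hypothesis rho_gt0 : forall x, 0 <= x <= b -> 0 < rho x.
Hypothesis rho_der : forall x, 0 < x < b -> is_derive x 1 rho (drho x).
Variables (p mu : R).
Hypothesis p01 : 0 < p < 1.
Hypothesis mu0 : 0 < mu.
Implicit Types (c x w v e : R) (n : nat).

(** The logarithmic derivative of v^2/2 + rho^2 G(w) is controlled by rho'/rho
    alone, because the powers of rho in the two terms have been chosen so that
    the contributions of the equation cancel.  The energy lies between multiples
    of r^2 and of r + r^2, whatever the truncation; hence the form of the two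
    bounds. *)
Lemma energy_estimate : exists2 C : R, 0 < C & forall n (w v : R -> R),
  {within `[0, b], continuous w} -> {within `[0, b], continuous v} ->
  (forall x, 0 < x < b -> is_derive x 1 w (v x / rho x)) ->
  (forall x, 0 < x < b -> is_derive x 1 v (- (rho x * truncated_force p mu n (w x)))) ->
  forall x (r0 r : R), 0 <= x <= b -> 0 <= r0 -> 0 <= r ->
    w 0 ^+ 2 + v 0 ^+ 2 = r0 ^+ 2 -> w x ^+ 2 + v x ^+ 2 = r ^+ 2 ->
    r ^+ 2 <= C * (r0 + r0 ^+ 2) /\ r0 ^+ 2 <= C * (r + r ^+ 2).
Proof.
have [m m0 rhom] := positive_within (ltW b0) rho_cont rho_gt0.
have [M M0 rhoM] := bounded_within (ltW b0) rho_cont.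
have [D D0 drhoD] := bounded_within (ltW b0) drho_cont.
pose k : R := 2 * D / m.
pose c1 := Num.min (1 / 2) (m ^+ 2 * (mu / 2)).
pose c2 := 1 / 2 + M ^+ 2 * (mu + 1).
have mu00 := mu0.
have m2 : 0 < m ^+ 2 by rewrite exprn_gt0.
have M2 : 0 < M ^+ 2 by rewrite exprn_gt0.
have k0 : 0 < k by rewrite !(divr_gt0, mulr_gt0).
have c10 : 0 < c1 by rewrite lt_min divr_gt0//= mulr_gt0// divr_gt0.
have c20 : 0 < c2.
  by rewrite /c2 ltr_wpDr// mulr_ge0 ?ltW// addr_gt0.
have eb0 : 0 < expR (k * b) by exact: expR_gt0.
exists (c2 * expR (k * b) / c1); first by rewrite divr_gt0// mulr_gt0.
move=> n w v cw cv dw dv x r0 r /andP[x0 xb] r00 rr0 Er0 Er.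
have [G [dG Gge Gle]] := truncated_potential p01 mu0 n.
pose E y := v y * v y / 2 + rho y * rho y * G (w y).
have G0 y : 0 <= G y.
  by apply: le_trans (Gge y); rewrite mulr_ge0 ?sqr_ge0// divr_ge0 ?ltW.
(* The energy lies between multiples of s^2 and of s + s^2. *)
have Elow y s : 0 <= y <= b -> w y ^+ 2 + v y ^+ 2 = s ^+ 2 -> c1 * s ^+ 2 <= E y.
  move=> yb Es; rewrite -Es mulrDr /E -!expr2 addrC lerD//.
    have : c1 <= 1 / 2 by rewrite ge_min lexx.
    by move=> /(ler_wpM2r (sqr_ge0 (v y))); lra.
  apply: (@le_trans _ _ (m ^+ 2 * (mu / 2) * w y ^+ 2)).
    by rewrite ler_wpM2r ?sqr_ge0// ge_min lexx orbT.
  rewrite -mulrA; apply: ler_pM => //.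
  - exact: ltW.
  - by rewrite mulr_ge0 ?sqr_ge0// divr_ge0// ltW.
  - by rewrite ler_sqr ?nnegrE ?rhom// ltW// rho_gt0.
have Eup y s : 0 <= y <= b -> 0 <= s -> w y ^+ 2 + v y ^+ 2 = s ^+ 2 ->
    E y <= c2 * (s + s ^+ 2).
  move=> yb s0 Es.
  have v2 : v y ^+ 2 <= s ^+ 2 by have := sqr_ge0 (w y); lra.
  have ws : `|w y| <= s.
    rewrite -(ger0_norm s0) -ler_sqr ?nnegrE// !real_normK ?num_real//.
    by have := sqr_ge0 (v y); lra.
  have h1 : rho y ^+ 2 <= M ^+ 2.
    rewrite ler_sqr ?nnegrE ?(ltW M0) ?(ltW (rho_gt0 yb))//.
    exact: le_trans (ler_norm _) (rhoM y yb).
  have h2 : G (w y) <= s * ((mu + 1) * s + 1).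
    apply: le_trans (Gle _) _; apply: ler_pM => //.
      by rewrite addr_ge0// mulr_ge0// addr_ge0// ltW.
    by rewrite lerD2r ler_wpM2l// addr_ge0// ltW.
  have h3 : rho y ^+ 2 * G (w y) <= M ^+ 2 * (s * ((mu + 1) * s + 1)).
    by apply: ler_pM => //; exact: sqr_ge0.
  have h4 : M ^+ 2 * (s * ((mu + 1) * s + 1)) <= M ^+ 2 * (mu + 1) * (s + s ^+ 2).
    rewrite -mulrA ler_pM2l//.
    have : 0 <= mu * s by rewrite mulr_ge0// ltW.
    rewrite expr2; lra.
  rewrite /E -!expr2 /c2 mulrDl; apply: lerD; last exact: le_trans h4.
  lra.
(* The terms in v * force cancel, and only the derivative of rho^2 remains. *)
have dE y : 0 < y < b -> is_derive y 1 E (2 * drho y * rho y * G (w y)).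
  move=> yb; have yb' : 0 <= y <= b by case/andP: yb => ? ?; rewrite !ltW.
  have rn : rho y != 0 by rewrite gt_eqF// rho_gt0.
  have d1 := is_derive_mulf (dv y yb) (dv y yb).
  have d2 := is_derive_mulf (rho_der yb) (rho_der yb).
  have d3 := is_derive_mulf d2 (is_derive_compf (dG (w y)) (dw y yb)).
  have d4 := is_derive_mulf d1 (is_derive_cstf (2^-1) y).
  apply: (is_derive_eq (is_derive_addf d4 d3)).
  by rewrite -/(truncated_force p mu n (w y)); field.
have cE : {within `[0, b], continuous E}.
  have cG : continuous G by move=> s; exact: (is_derive_cont (dG s)).
  apply: within_continuousD; apply: within_continuousM; try exact: within_continuousM.
    exact: within_continuous_cst.
  exact: within_continuous_comp cw cG.
have : E x <= E 0 * expR (k * x) /\ E 0 <= E x * expR (k * x).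
  apply: (@gronwall R E (fun y => 2 * drho y * rho y * G (w y)) k x x0).
  - by move=> y /andP[y0 yx]; apply: dE; rewrite y0 (lt_le_trans yx).
  - by apply: continuous_subspaceW cE; apply: subset_itvl; rewrite bnd_simp.
  - move=> y /andP[y0 yx]; have yb : 0 <= y <= b by rewrite (ltW y0)/= (le_trans (ltW yx)).
    have hd := drhoD y yb; have hr := rhom y yb; have r0' := rho_gt0 yb.
    rewrite !normrM (gtr0_norm r0') (ger0_norm (G0 _)) ger0_norm//.
    apply: (@le_trans _ _ (k * (rho y * rho y * G (w y)))); last first.
      rewrite ler_pM2l// lerDr divr_ge0// -expr2 sqr_ge0//.
    rewrite mulrA ler_wpM2r// mulrA ler_wpM2r ?(ltW r0')//.
    apply: (@le_trans _ _ (2 * D)); first by rewrite ler_pM2l.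
    by rewrite /k mulrAC ler_pdivlMr// ler_pM2l// mulr_gt0.
case=> H1 H2.
have e1 : expR (k * x) <= expR (k * b) by rewrite ler_expR ler_wpM2l// ltW.
have xb' : 0 <= x <= b by rewrite x0.
have zb : 0 <= (0 : R) <= b by apply/andP; split => //; exact: ltW.
have s0 s : 0 <= s -> 0 <= c2 * (s + s ^+ 2).
  by move=> ?; apply: mulr_ge0; [exact: ltW|rewrite addr_ge0 ?sqr_ge0].
have fin s t : 0 <= s -> c1 * t ^+ 2 <= c2 * (s + s ^+ 2) * expR (k * x) ->
    t ^+ 2 <= c2 * expR (k * b) / c1 * (s + s ^+ 2).
  move=> ss H; rewrite mulrAC ler_pdivlMr// mulrC; apply: le_trans H _.
  by rewrite -[leRHS]mulrAC ler_wpM2l// s0.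
split; apply: fin => //.
- apply: le_trans (Elow x r xb' Er) _; apply: le_trans H1 _.
  by rewrite ler_wpM2r ?expR_ge0//; exact: Eup.
- apply: le_trans (Elow 0 r0 zb Er0) _; apply: le_trans H2 _.
  by rewrite ler_wpM2r ?expR_ge0//; exact: Eup.
Qed.

(** The flow of the truncated system in polar coordinates, with the two bounds on
    the angular speed that the shooting argument compares: a lower bound where the
    force has slope at least k^2, and an upper bound, uniform in the
    truncation, at distance at least r from the origin. *)
Lemma phase_flow th0 : exists2 m : R, 0 < m & forall n,
  exists th l dth : R -> R -> R,
  let w c x := expR (l c x) * sin (th c x) in
  let v c x := expR (l c x) * cos (th c x) in
  [/\ (forall c, th c 0 = th0 /\ l c 0 = c) /\ continuous (th ^~ b),
      forall c, [/\ {within `[0, b], continuous (th c)},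
                    {within `[0, b], continuous (w c)}
                  & {within `[0, b], continuous (v c)}],
      forall c x, 0 < x < b -> is_derive x 1 (w c) (v c x / rho x) /\
         is_derive x 1 (v c) (- (rho x * truncated_force p mu n (w c x))),
      forall c x, 0 < x < b -> is_derive x 1 (th c) (dth c x)
    & forall c x, 0 < x < b ->
      (forall k : R, k ^+ 2 * w c x ^+ 2 <= w c x * truncated_force p mu n (w c x) ->
        m * (cos (th c x) ^+ 2 + k ^+ 2 * sin (th c x) ^+ 2) <= dth c x) /\
      (forall r : R, 0 < r -> r <= expR (l c x) ->
        `|dth c x| <= m^-1 * (mu + 2 + r^-1))].
Proof.
have [m' m'0 rhom] := positive_within (ltW b0) rho_cont rho_gt0.
have [M' M'0 rhoM] := bounded_within (ltW b0) rho_cont.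
pose M : R := m'^-1 + M'.
have im'0 : 0 < m'^-1 by rewrite invr_gt0.
have M0 : 0 < M by rewrite /M; lra.
have M_m : M^-1 <= m'.
  rewrite -[leRHS]invrK lef_pV2 ?posrE ?invr_gt0// /M; lra.
have MVM : M^-1 <= M'^-1 by rewrite lef_pV2 ?posrE// /M; lra.
exists M^-1; first by rewrite invr_gt0.
move=> n; pose K : R := mu + n%:R.
have K0 : 0 <= K by rewrite addr_ge0// ltW.
pose al x := (rho (clamp 0 b x))^-1; pose be x := rho (clamp 0 b x).
have cb x : 0 <= clamp 0 b x <= b by exact/clamp_itv/ltW.
have bec : continuous be by exact: continuous_clamp (ltW b0) rho_cont.
have alc : continuous al.
  by move=> x; apply: cvgV; [rewrite gt_eqF// rho_gt0|exact: bec].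
have be0 x : 0 < be x by exact: rho_gt0.
have alM x : `|al x| <= M.
  rewrite gtr0_norm ?invr_gt0 ?be0//; apply: (@le_trans _ _ m'^-1).
    by rewrite lef_pV2 ?posrE//; [exact: rhom|exact: be0].
  by rewrite /M; lra.
have beM x : `|be x| <= M.
  by apply: le_trans (rhoM _ (cb x)) _; rewrite /M; lra.
pose g := truncated_force p mu n.
have glip s t : `|g s - g t| <= K * `|s - t| by exact: truncated_force_lipschitz.
have g0 : g 0 = 0 by rewrite /g /truncated_force truncated_power0 mulr0 addr0.
have [th [l [[thi li] dth dl cthl thb]]] := prufer_flow K0 glip g0 M0 alc bec alM beM th0.
exists th, l, (fun c x => al x * cos (th c x) ^+ 2 +
         be x * (sin (th c x) * polar_force g (th c x) (l c x))) => w v.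
have cth c : {within `[0, b], continuous (th c)} by have [] := cthl c b.
have cl c : {within `[0, b], continuous (l c)} by have [] := cthl c b.
have eE c x : expR (- l c x) * expR (l c x) = 1 by rewrite -expRD addNr expR0.
have qE c x : expR (l c x) * polar_force g (th c x) (l c x) = g (w c x).
  by rewrite /polar_force mulrA [_ * expR (- _)]mulrC eE mul1r.
have cs x : cos x ^+ 2 = 1 - sin x ^+ 2 by have := cos2Dsin2 x; lra.
split.
- by split=> // c; exact: thb (ltW b0) c.
- move=> c; split=> //.
  + by apply: within_continuousM; apply: within_continuous_comp => //;
      [exact: continuous_expR|exact: continuous_sin].
  + by apply: within_continuousM; apply: within_continuous_comp => //;
      [exact: continuous_expR|exact: continuous_cos].
- move=> c x /andP[x0 xb].
  have xx : clamp 0 b x = x by rewrite clamp_id// !ltW.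
  have de := is_derive_compf (is_derive_expR (l c x)) (dl c x x0).
  have ds := is_derive_compf (is_derive_sin (th c x)) (dth c x x0).
  have dc := is_derive_compf (is_derive_cos (th c x)) (dth c x x0).
  have c2 := cs (th c x).
  split.
  + apply: (is_derive_eq (is_derive_mulf de ds)).
    rewrite /v /al xx -/(al x); move: (rho x)^-1 (be x) => A B.
    move: (polar_force _ _ _) c2; move: (cos _) (sin _) (expR _) => C S E Q c2.
    have -> : E * (S * C * A - B * (C * Q)) * S + E * (C * (A * C ^+ 2 + B * (S * Q))) =
      E * C * A * (C ^+ 2 + S ^+ 2) by ring.
    by rewrite c2 subrK mulr1.
  + apply: (is_derive_eq (is_derive_mulf de dc)).
    rewrite -/(g _) -qE /be xx -/(be x); move: (al x) (rho x) => A B.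
    move: (polar_force _ _ _) c2; move: (cos _) (sin _) (expR _) => C S E Q c2.
    have -> : E * (S * C * A - B * (C * Q)) * C + E * (- S * (A * C ^+ 2 + B * (S * Q))) =
      - (B * (E * Q)) * (C ^+ 2 + S ^+ 2) by ring.
    by rewrite c2 subrK mulr1.
- by move=> c x /andP[x0 _]; exact: dth.
- move=> c x /andP[x0 xb].
  have xx : clamp 0 b x = x by rewrite clamp_id// !ltW.
  have xb' : 0 <= x <= b by rewrite !ltW.
  have alm : M^-1 <= al x.
    apply: le_trans MVM _; rewrite lef_pV2 ?posrE ?be0//.
    by apply: le_trans (ler_norm _) _; exact: rhoM.
  have bem : M^-1 <= be x by apply: le_trans M_m _; exact: rhom.
  have iM0 : 0 < M^-1 by rewrite invr_gt0.
  have E0 := expR_gt0 (l c x).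
  split.
  + move=> k Hk; rewrite mulrDr; apply: lerD.
      by rewrite ler_wpM2r ?sqr_ge0.
    have Hq : k ^+ 2 * sin (th c x) ^+ 2 <= sin (th c x) * polar_force g (th c x) (l c x).
      have E2 : 0 < expR (l c x) ^+ 2 by rewrite exprn_gt0.
      rewrite -(ler_pM2l E2).
      move: Hk; rewrite -/(g _) -qE /w exprMn.
      by move: (polar_force _ _ _); move: (sin _) (expR _) => S E Q; rewrite expr2; lra.
    apply: (@le_trans _ _ (be x * (k ^+ 2 * sin (th c x) ^+ 2))).
      by rewrite ler_wpM2r// mulr_ge0 ?sqr_ge0.
    by rewrite ler_pM2l.
  + move=> r r0 rl; rewrite invrK.
    have Hq : `|polar_force g (th c x) (l c x)| <= mu + 1 + r^-1.
      rewrite -(ler_pM2l E0) -[X in X * `|_|](gtr0_norm E0) -normrM qE.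
      apply: le_trans (norm_truncated_force_le p01 mu0 n _) _.
      have wE : `|w c x| <= expR (l c x).
        by rewrite normrM (gtr0_norm E0) ler_piMr ?norm_sin_le1// ltW.
      have h1 : (mu + 1) * `|w c x| <= (mu + 1) * expR (l c x).
        by rewrite ler_wpM2l// addr_ge0// ltW.
      have h2 : 1 <= expR (l c x) / r by rewrite ler_pdivlMr// mul1r.
      rewrite [leRHS]mulrDr [_ * (mu + 1)]mulrC; lra.
    apply: le_trans (ler_normD _ _) _.
    have -> : M * (mu + 2 + r^-1) = M * 1 + M * (1 * (mu + 1 + r^-1)) by ring.
    apply: lerD; rewrite normrM; apply: ler_pM => //.
      by rewrite normrX exprn_ile1// norm_cos_le1.
    by rewrite normrM; apply: ler_pM => //; exact: norm_sin_le1.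
Qed.

(** The initial radius A0 keeps the trajectory within distance e of the origin and
    gives a rotation of at most M0 b; the radius A1 is so small that the force
    seen by the trajectory has slope at least k^2, and gives a rotation of at
    least M0 b + pi.  All these constants are chosen before n. *)
Lemma shooting (s0 A2 B2 e : R) : 0 < e ->
  exists2 r1 : R, 0 < r1 & exists n0 : R, forall n, n0 <= n%:R ->
  exists w v : R -> R,
  [/\ {within `[0, b], continuous w} /\ {within `[0, b], continuous v},
      forall x, 0 < x < b -> is_derive x 1 w (v x / rho x),
      forall x, 0 < x < b ->
        is_derive x 1 v (- (rho x * truncated_force p mu n (w x))),
      v 0 = s0 * w 0 /\ A2 * w b + B2 * v b = 0
    & forall x, 0 <= x <= b -> r1 <= w x ^+ 2 + v x ^+ 2 <= e ^+ 2].
Proof.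
move=> e0.
have [C C0 energy] := energy_estimate.
pose th0 : R := pi / 2 - atan s0.
have [m m0 flow] := phase_flow th0.
have bb := b0; have mmu := mu0; have pi0 := pi_gt0 R.
(* [small d] is an initial radius that keeps a trajectory within distance d of the
   origin, [low A] a lower bound for the radius when the initial radius is A.
   Both come from a + a^2 <= 2 a for a <= 1. *)
pose small d : R := Num.min 1 (d ^+ 2 / (2 * C)).
have small_gt0 d : 0 < d -> 0 < small d.
  by move=> d0; rewrite lt_min ltr01/= divr_gt0// ?exprn_gt0// mulr_gt0.
have smallP d a : 0 < a -> a <= small d -> C * (a + a ^+ 2) <= d ^+ 2.
  move=> a0; rewrite le_min => /andP[a1]; rewrite ler_pdivlMr ?mulr_gt0//.
  have : C * a ^+ 2 <= C * a.
    by rewrite ler_pM2l// expr2 ler_piMl// ltW.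
  lra.
pose low A : R := Num.min 1 (A ^+ 2 / (2 * C)).
have low_gt0 A : 0 < A -> 0 < low A := small_gt0 A.
have lowP A r : 0 <= r -> A ^+ 2 <= C * (r + r ^+ 2) -> low A <= r.
  move=> r0 H; rewrite ge_min; case: (leP 1 r) => //= r1.
  rewrite ler_pdivrMr ?mulr_gt0//.
  have : C * r ^+ 2 <= C * r.
    by rewrite ler_pM2l// expr2 ler_piMl// ltW.
  lra.
pose A0 := small e; have A00 : 0 < A0 by exact: small_gt0.
pose r0 := low A0; have r00 : 0 < r0 by exact: low_gt0.
pose M0 := m^-1 * (mu + 2 + r0^-1).
have M00 : 0 < M0 by rewrite mulr_gt0 ?invr_gt0// !addr_gt0// invr_gt0.
pose k := Num.max 1 ((M0 * b + 2 * pi) / (m * b)).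
have k1 : 1 <= k by rewrite le_max lexx.
have kb : M0 * b + 2 * pi <= m * k * b.
  have -> : m * k * b = k * (m * b) by ring.
  rewrite -ler_pdivrMr ?mulr_gt0//.
  by rewrite /k le_max lexx orbT.
have k0 : 0 < k by lra.
have [a a0 steep] := truncated_power_steep p01 (exprn_gt0 2 k0).
pose A1 := Num.min A0 (small a).
have A10 : 0 < A1 by rewrite lt_min A00 small_gt0.
have A1A0 : A1 <= A0 by rewrite ge_min lexx.
exists (low A1 ^+ 2); first by rewrite exprn_gt0// low_gt0.
exists (k ^+ 2) => n nk.
have [th [l [dth]]] := flow n.
set w := fun c x => _; set v := fun c x => _.
move=> [[init cthb] cts dwv dthP speed].
have radius c x : w c x ^+ 2 + v c x ^+ 2 = expR (l c x) ^+ 2.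
  rewrite /w /v !exprMn -mulrDr.
  have -> : sin (th c x) ^+ 2 + cos (th c x) ^+ 2 = 1 by rewrite addrC cos2Dsin2.
  by rewrite mulr1.
have bounds c x : 0 <= x <= b ->
    expR (l c x) ^+ 2 <= C * (expR c + expR c ^+ 2) /\
    expR c ^+ 2 <= C * (expR (l c x) + expR (l c x) ^+ 2).
  move=> xb; have [_ cw cv] := cts c.
  apply: (energy n (w c) (v c) cw cv (fun y yb => (dwv c y yb).1)
    (fun y yb => (dwv c y yb).2) x) => //; rewrite ?expR_ge0//.
  by rewrite radius (init c).2.
have open x : 0 < x < b -> 0 <= x <= b by case/andP=> *; rewrite !ltW.
have th_c c : th c 0 = th0 by have [] := init c.
pose c0 := ln A0; pose c1 := ln A1.
have ec0 : expR c0 = A0 by rewrite lnK// posrE.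
have ec1 : expR c1 = A1 by rewrite lnK// posrE.
have c10 : c1 <= c0 by rewrite -ler_expR ec0 ec1.
have slow : th c0 b - th0 <= M0 * b.
  rewrite -(th_c c0) -[X in M0 * X]subr0.
  apply: le_trans (ler_norm _) _.
  apply: (lipschitz_is_derive (ltW b0) (dthP c0)); last by have [] := cts c0.
  move=> x xb; apply: (speed c0 x xb).2 => //.
  apply: lowP; first exact: expR_ge0.
  by have [_] := bounds c0 x (open x xb); rewrite ec0.
have fast : M0 * b + pi <= th c1 b - th0.
  (* k was chosen for this inequality: m k b is at least M0 b + 2 pi. *)
  apply: (@le_trans _ _ (m * k * b - pi)); first by lra.
  rewrite -(th_c c1); apply: (rotation_ge (ltW m0) k1 (ltW b0) (dthP c1)).
    by have [] := cts c1.
  move=> x xb; apply: (speed c1 x xb).1.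
  have wa : `|w c1 x| <= a.
    have [+ _] := bounds c1 x (open x xb); rewrite ec1 => H.
    have H2 : C * (A1 + A1 ^+ 2) <= a ^+ 2 by apply: smallP; rewrite // ge_min lexx orbT.
    rewrite -(ger0_norm (ltW a0)) -ler_sqr ?nnegrE// !real_normK ?num_real//.
    by have := radius c1 x; have := sqr_ge0 (v c1 x); lra.
  have := steep n (w c1 x) nk wa; rewrite /truncated_force mulrDr.
  have : 0 <= w c1 x * (mu * w c1 x) by rewrite mulrCA mulr_ge0 -?expr2 ?sqr_ge0// ltW.
  lra.
have [t /andP[t0 t1] tz] := zero_on_half_turn A2 B2 (th c0 b).
have [|c cI ct] := IVT (f := th ^~ b) (v := t) c10 (continuous_subspaceT cthb).
  by rewrite ge_min le_max t0 orbT/= (_ : t <= th c1 b)//; lra.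
have [cth cw cv] := cts c.
exists (w c), (v c); split.
- by [].
- by move=> x xb; exact: (dwv c x xb).1.
- by move=> x xb; exact: (dwv c x xb).2.
- split.
    rewrite /v /w th_c /th0 (init c).2.
    have -> : sin (pi / 2 - atan s0) = cos (atan s0) by rewrite sinB sin_pihalf cos_pihalf; lra.
    have -> : cos (pi / 2 - atan s0) = sin (atan s0) by rewrite cosB sin_pihalf cos_pihalf; lra.
    rewrite mulrCA; congr (_ * _).
    by rewrite -{2}(atanK s0) /tan divfK// gt_eqF// cos_gt0_pihalf// atan_gtNpi2 atan_ltpi2.
  rewrite /w /v ct.
  have -> : A2 * (expR (l c b) * sin t) + B2 * (expR (l c b) * cos t) =
    expR (l c b) * (A2 * sin t + B2 * cos t) by ring.
  by rewrite tz mulr0.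
- move=> x xb; rewrite radius; have [H1 H2] := bounds c x xb.
  move: cI; rewrite in_itv/= => /andP[cc1 cc0].
  have ec : A1 <= expR c by rewrite -ec1 ler_expR.
  have ec' : expR c <= A0 by rewrite -ec0 ler_expR.
  apply/andP; split; last first.
    by apply: le_trans H1 _; apply: smallP; rewrite ?expR_gt0.
  rewrite ler_sqr ?nnegrE ?expR_ge0 ?(ltW (low_gt0 _ A10))//.
  apply: lowP; first exact: expR_ge0.
  apply: le_trans H2; rewrite ler_sqr ?nnegrE ?expR_ge0//; exact: ltW.
Qed.

(** The truncated solutions stay in a fixed annulus and are equi-Lipschitz, and so
    converge pointwise along an ultrafilter, to a solution of the equation with
    the untruncated force by [is_derive_lim].  The inner radius of the annulus
    keeps the limit away from the trivial solution. *)
Theorem small_stationary_solution (s0 A2 B2 e : R) : 0 < e ->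
  exists w v : R -> R,
  [/\ {within `[0, b], continuous w} /\ {within `[0, b], continuous v},
      forall x, 0 < x < b -> is_derive x 1 w (v x / rho x),
      forall x, 0 < x < b ->
        is_derive x 1 v (- (rho x * (mu * w x + signed_power p (w x)))),
      v 0 = s0 * w 0 /\ A2 * w b + B2 * v b = 0
    & (forall x, 0 <= x <= b -> `|w x| <= e) /\ w 0 != 0].
Proof.
move=> e0.
have [r1 r10 [n0 shoot]] := shooting s0 A2 B2 e0.
have [m m0 rhom] := positive_within (ltW b0) rho_cont rho_gt0.
have [M M0 rhoM] := bounded_within (ltW b0) rho_cont.
pose N := (Num.truncn n0).+1.
have nN n : n0 <= (n + N)%:R.
  apply: (@le_trans _ _ N%:R); first by rewrite ltW// truncnS_gt.
  by rewrite ler_nat leq_addl.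
have /choice[WV WVP] : forall n, exists wv : (R -> R) * (R -> R),
  [/\ {within `[0, b], continuous wv.1} /\ {within `[0, b], continuous wv.2},
      forall x, 0 < x < b -> is_derive x 1 wv.1 (wv.2 x / rho x),
      forall x, 0 < x < b ->
        is_derive x 1 wv.2 (- (rho x * truncated_force p mu (n + N) (wv.1 x))),
      wv.2 0 = s0 * wv.1 0 /\ A2 * wv.1 b + B2 * wv.2 b = 0
    & forall x, 0 <= x <= b -> r1 <= wv.1 x ^+ 2 + wv.2 x ^+ 2 <= e ^+ 2].
  by move=> n; have [w [v wvP]] := shoot _ (nN n); exists (w, v).
pose W n := (WV n).1; pose V n := (WV n).2; pose g n := truncated_force p mu (n + N).
have sqle (s t : R) : s ^+ 2 + t ^+ 2 <= e ^+ 2 -> `|s| <= e.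
  move=> H; rewrite -(ger0_norm (ltW e0)) -ler_sqr ?nnegrE// !real_normK ?num_real//.
  by have := sqr_ge0 t; lra.
have We n x : 0 <= x <= b -> `|W n x| <= e.
  by have [_ _ _ _ H] := WVP n; move=> /H/andP[_]; exact: sqle.
have Ve n x : 0 <= x <= b -> `|V n x| <= e.
  by have [_ _ _ _ H] := WVP n; move=> /H/andP[_]; rewrite addrC; exact: sqle.
have open x : 0 < x < b -> 0 <= x <= b by case/andP=> *; rewrite !ltW.
pose Kg := (mu + 1) * e + 1.
have Kg0 : 0 < Kg by rewrite ltr_wpDl// mulr_ge0 ?(ltW e0)// addr_ge0// ltW.
have gK n x : 0 <= x <= b -> `|g n (W n x)| <= Kg.
  move=> xb; apply: le_trans (norm_truncated_force_le p01 mu0 _ _) _.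
  by rewrite lerD2r ler_wpM2l ?We// addr_ge0// ltW.
pose Kw := e / m; pose Kv := M * Kg.
have Kw0 : 0 < Kw by rewrite divr_gt0.
have Kv0 : 0 < Kv by rewrite mulr_gt0.
have dW n x : 0 < x < b -> is_derive x 1 (W n) (V n x / rho x).
  by have [_ H _ _ _] := WVP n; exact: H.
have dV n x : 0 < x < b -> is_derive x 1 (V n) (- (rho x * g n (W n x))).
  by have [_ _ H _ _] := WVP n; exact: H.
have dWle n x : 0 < x < b -> `|V n x / rho x| <= Kw.
  move=> /open xb; rewrite normrM; apply: ler_pM => //; first exact: Ve.
  by rewrite gtr0_norm ?invr_gt0 ?rho_gt0// lef_pV2 ?posrE ?rhom// rho_gt0.
have dVle n x : 0 < x < b -> `|- (rho x * g n (W n x))| <= Kv.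
  move=> /open xb; rewrite normrN normrM; apply: ler_pM => //; first exact: rhoM.
  exact: gK.
have lip (f df : R -> R) (K : R) : {within `[0, b], continuous f} ->
    (forall x, 0 < x < b -> is_derive x 1 f (df x)) ->
    (forall x, 0 < x < b -> `|df x| <= K) ->
    forall x y, 0 <= x <= b -> 0 <= y <= b -> `|f y - f x| <= K * `|y - x|.
  move=> cf dfP dfK x y; wlog xy : x y / x <= y.
    move=> H; have [xy|/ltW yx] := leP x y; first exact: H.
    by move=> *; rewrite distrC (distrC y); exact: H.
  move=> /andP[x0 xb] /andP[y0 yb]; rewrite (@ger0_norm _ (y - x)) ?subr_ge0//.
  have sub z : x < z < y -> 0 < z < b.
    by move=> /andP[xz zy]; rewrite (le_lt_trans x0)//= (lt_le_trans zy).
  apply: (@lipschitz_is_derive _ f df) => //.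
  - by move=> z /sub; exact: dfP.
  - by move=> z /sub; exact: dfK.
  - by apply: continuous_subspaceW cf; apply: subset_itv; rewrite bnd_simp.
have lipW n x y : 0 <= x <= b -> 0 <= y <= b -> `|W n y - W n x| <= Kw * `|y - x|.
  by have [[cw _] _ _ _ _] := WVP n; exact: lip cw (dW n) (dWle n) x y.
have lipV n x y : 0 <= x <= b -> 0 <= y <= b -> `|V n y - V n x| <= Kv * `|y - x|.
  by have [[_ cv] _ _ _ _] := WVP n; exact: lip cv (dV n) (dVle n) x y.
have [F [FU ooF]] := @ultraFilterLemma nat \oo eventually_filter.
have FP : ProperFilter F by exact: ultra_proper.
have limP (u : nat -> R -> R) : (forall n x, 0 <= x <= b -> `|u n x| <= e) ->
    exists f : R -> R, forall x, 0 <= x <= b -> u n x @[n --> F] --> f x.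
  move=> ue; have /choice[f fP] : forall x, exists l : R, 0 <= x <= b -> u n x @[n --> F] --> l.
    move=> x; case: (boolP (0 <= x <= b)) => [xb|xb]; last by exists 0.
    have [l lP] := ultra_cvg_bounded FU (fun n => ue n x xb).
    by exists l.
  by exists f.
have [w wP] := limP W We; have [v vP] := limP V Ve.
have near_oo (x : R) : \forall n \near F, x <= (n + N)%:R.
  apply: ooF; exists (Num.truncn x).+1 => // n /= xn.
  apply: (@le_trans _ _ (Num.truncn x).+1%:R); first by rewrite ltW// truncnS_gt.
  by rewrite ler_nat (leq_trans xn)// leq_addr.
have passle (f : nat -> R) (l K : R) : f n @[n --> F] --> l ->
    (\forall n \near F, f n <= K) -> l <= K.
  by move=> fl H; rewrite -(cvg_lim _ fl)//; apply: limr_le => //; apply/cvg_ex; exists l.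
have lipw x y : 0 <= x <= b -> 0 <= y <= b -> `|w y - w x| <= Kw * `|y - x|.
  move=> xb yb; apply: (passle (fun n => `|W n y - W n x|)).
    by apply: cvg_norm; apply: cvgB; exact: wP.
  by apply: nearW => n; exact: lipW.
have lipv x y : 0 <= x <= b -> 0 <= y <= b -> `|v y - v x| <= Kv * `|y - x|.
  move=> xb yb; apply: (passle (fun n => `|V n y - V n x|)).
    by apply: cvg_norm; apply: cvgB; exact: vP.
  by apply: nearW => n; exact: lipV.
have itvE (x : R) : `[0, b]%classic x -> 0 <= x <= b by rewrite /= in_itv.
have contx (f : R -> R) x : {within `[0, b], continuous f} -> 0 < x < b -> {for x, continuous f}.
  move=> cf xb; have [] := (continuous_within_itvP f b0).1 cf.
  by move=> H _ _; apply: H; rewrite in_itv.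
have zb : 0 <= (0 : R) <= b by apply/andP; split => //; exact: ltW.
have bb : 0 <= b <= b by apply/andP; split => //; exact: ltW.
have iveq (f h : nat -> R) (l l' : R) : f n @[n --> F] --> l -> h n @[n --> F] --> l' ->
    f =1 h -> l = l'.
  move=> fl hl fh; rewrite -(cvg_lim _ fl)// -(cvg_lim _ hl)//.
  by congr (lim (_ @ F)); exact/funext.
have v0E : v 0 = s0 * w 0.
  apply: (@iveq (V ^~ 0) (fun n => s0 * W n 0)); first exact: vP.
    by apply: cvgMl_tmp; exact: wP.
  by move=> n; have [_ _ _ [H _] _] := WVP n.
have vbE : A2 * w b + B2 * v b = 0.
  apply: (@iveq (fun n => A2 * W n b + B2 * V n b) (fun=> 0)).
  - by apply: cvgD; apply: cvgMl_tmp; [exact: wP|exact: vP].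
  - exact: cvg_cst.
  - by move=> n; have [_ _ _ [_ H] _] := WVP n.
exists w, v; split => //.
- split; [apply: (continuous_within_lipschitz Kw0)|apply: (continuous_within_lipschitz Kv0)].
    by move=> x y /itvE xb /itvE yb; exact: lipw.
  by move=> x y /itvE xb /itvE yb; exact: lipv.
- move=> x xb; have xb' := open _ xb.
  apply: (@is_derive_lim R nat F _ W (fun n y => V n y / rho y) w _ 0 b) => //.
  + by move=> y /open; exact: wP.
  + by apply: cvgMr_tmp; exact: vP.
  + move=> d d0.
    have civ : {for x, continuous (fun y => (rho y)^-1)}.
      apply: cvgV; first by rewrite gt_eqF// rho_gt0.
      exact: contx.
    have /cvgrPdist_le/(_ (d / 2 / e)) := civ.
    case; first by rewrite !divr_gt0.
    move=> r r0 Hr; exists (Num.min (r / 2) (d / 2 / (Kv / m))).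
      by rewrite lt_min !divr_gt0.
    apply: nearW => n y /open yb; rewrite le_min => /andP[yr yK].
    have h1 : `|V n y| <= e by exact: Ve.
    have h2 : `|(rho x)^-1| <= m^-1.
      by rewrite gtr0_norm ?invr_gt0 ?rho_gt0// lef_pV2 ?posrE ?rhom// rho_gt0.
    have h3 : `|(rho y)^-1 - (rho x)^-1| <= d / 2 / e.
      rewrite distrC; apply: Hr; rewrite /= distrC (le_lt_trans yr)//.
      by rewrite ltr_pdivrMr// ltr_pMr// ltr1n.
    apply: le_trans (norm_mulB_le h1 h2 (lipV n x y xb' yb) h3) _.
    rewrite mulrC divfK ?gt_eqF//.
    have : Kv * `|y - x| * m^-1 <= d / 2.
      by rewrite mulrAC mulrC -ler_pdivlMr// divr_gt0.
    lra.
- move=> x xb; have xb' := open _ xb.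
  apply: (@is_derive_lim R nat F _ V (fun n y => - (rho y * g n (W n y))) v _ 0 b) => //.
  + by move=> y /open; exact: vP.
  + apply: cvgN; apply: cvgMl_tmp; rewrite /g /truncated_force.
    apply: cvgD; first by apply: cvgMl_tmp; exact: wP.
    have sp : signed_power p (W n x) @[n --> F] --> signed_power p (w x).
      by apply: (cvg_comp _ _ (wP x xb')); exact: signed_power_continuous.
    apply/cvgrPdist_le => /= d d0; move/cvgrPdist_le : sp => /(_ (d / 2)) sp.
    have d20 : 0 < d / 2 by rewrite divr_gt0.
    have [q _ Hq] := truncated_power_approx p01 d20.
    apply: filterS2 (sp d20) (near_oo q) => n h1 h2.
    by have := Hq _ (W n x) h2; move: h1; rewrite !ler_norml; lra.
  + move=> d d0.
    have d1 : 0 < d / 2 / M / 8 by rewrite !divr_gt0.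
    have [q q0 Hq] := truncated_power_approx p01 d1.
    pose k := (Num.truncn q).+1.
    have qk : q <= k%:R by rewrite ltW// truncnS_gt.
    pose K := (mu + k%:R) * Kw.
    have K0 : 0 < K by rewrite mulr_gt0// ltr_wpDr.
    have /cvgrPdist_le/(_ (d / 2 / Kg)) := contx _ _ rho_cont xb.
    case; first by rewrite !divr_gt0.
    move=> r r0 Hr; exists (Num.min (r / 2) (d / 2 / M / 2 / K)).
      by rewrite lt_min !divr_gt0.
    apply: filterS (near_oo q) => n qn y /open yb; rewrite le_min => /andP[yr yK].
    have h1 : `|rho y| <= M by exact: rhoM.
    have h2 : `|g n (W n x)| <= Kg by exact: gK.
    have h3 : `|rho y - rho x| <= d / 2 / Kg.
      rewrite distrC; apply: Hr; rewrite /= distrC (le_lt_trans yr)//.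
      by rewrite ltr_pdivrMr// ltr_pMr// ltr1n.
    have h4 : `|g n (W n y) - g n (W n x)| <= d / 2 / M.
      (* The force g n is not Lipschitz uniformly in n, but uniformly close to a fixed
         truncation, which is. *)
      have h5 : `|truncated_force p mu k (W n y) - truncated_force p mu k (W n x)| <= d / 2 / M / 2.
        apply: le_trans (truncated_force_lipschitz p01 mu0 _ _ _) _.
        apply: (@le_trans _ _ ((mu + k%:R) * (Kw * `|y - x|))).
          by rewrite ler_wpM2l ?lipW// addr_ge0// ltW.
        by rewrite mulrA mulrC -ler_pdivlMr.
      move: h5 (Hq _ (W n x) qn) (Hq _ (W n y) qn) (Hq _ (W n x) qk) (Hq _ (W n y) qk).
      by rewrite /g /truncated_force !ler_norml; lra.
    rewrite -opprD normrN.
    apply: le_trans (norm_mulB_le h1 h2 h3 h4) _.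
    rewrite mulrC divfK ?gt_eqF// divfK ?gt_eqF//; lra.
- split=> [x xb|].
    apply: (passle (fun n => `|W n x|)); first by apply: cvg_norm; exact: wP.
    by apply: nearW => n; exact: We.
  apply/eqP => w00.
  have vw : r1 <= w 0 ^+ 2 + v 0 ^+ 2.
    rewrite -lerN2; apply: (passle (fun n => - (W n 0 ^+ 2 + V n 0 ^+ 2))).
      apply: cvgN; rewrite !expr2; apply: cvgD.
        by under eq_fun do rewrite expr2; apply: cvgM; exact: wP.
      by under eq_fun do rewrite expr2; apply: cvgM; exact: vP.
    by apply: nearW => n; rewrite lerN2; have [_ _ _ _ /(_ 0 zb)/andP[]] := WVP n.
  by move: vw; rewrite v0E w00 mulr0 expr0n addr0 leNgt r10.
Qed.

End Shooting.

(** * The weak derivative of the weight is a classical one *)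

Section Smooth.
Context {R : realType}.
Implicit Types (f g : R -> R) (n m : nat) (x : R).

Fixpoint differentiable_upto n f : Prop :=
  if n is n'.+1 then
    exists df : R -> R, (forall x, is_derive x 1 f (df x)) /\ differentiable_upto n' df
  else True.

Definition smooth f := forall n, differentiable_upto n f.

Lemma smooth_derivable f : smooth f -> forall n x, derivable (derive1n n f) x 1.
Proof.
move=> sf n; move: (sf n.+1); elim: n f {sf} => [|n IH] f /= [df [fdf sdf]] x.
  by have [] := fdf x.
rewrite (_ : derive1 (derive1n n f) = derive1n n df); first exact: IH.
rewrite -derive1nS derive1Sn; congr derive1n; apply/funext => y.
by rewrite derive1E; have [_ ->] := fdf y.
Qed.

Let uptoW n f : differentiable_upto n.+1 f -> differentiable_upto n f.
Proof.
elim: n f => [//|n IH] f [df [fdf sdf]]; exists df; split=> //; exact: IH.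
Qed.

Let uptoD n f g : differentiable_upto n f -> differentiable_upto n g ->
  differentiable_upto n (fun x => f x + g x).
Proof.
elim: n f g => [//|n IH] f g [df [fdf sdf]] [dg [gdg sdg]].
exists (fun x => df x + dg x); split; last exact: IH.
by move=> x; exact: is_derive_addf.
Qed.

Let uptoZ n (k : R) f : differentiable_upto n f ->
  differentiable_upto n (fun x => k * f x).
Proof.
elim: n f => [//|n IH] f [df [fdf sdf]].
exists (fun x => k * df x); split; last exact: IH.
by move=> x; exact: is_derive_scalef.
Qed.

Lemma smoothD f g : smooth f -> smooth g -> smooth (fun x => f x + g x).
Proof. by move=> sf sg n; exact: uptoD (sf n) (sg n). Qed.

Lemma smoothM f g : smooth f -> smooth g -> smooth (fun x => f x * g x).
Proof.
move=> sf sg n; move: (sf n) (sg n) => {sf sg}.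
elim: n f g => [//|n IH] f g sf sg.
have [df [fdf sdf]] := sf; have [dg [gdg sdg]] := sg.
exists (fun x => df x * g x + f x * dg x); split.
  by move=> x; exact: is_derive_mulf.
by apply: uptoD; apply: IH => //; exact: uptoW.
Qed.

Lemma smooth_cst (k : R) : smooth (fun=> k).
Proof.
move=> n; elim: n k => [//|n IH] k; exists (fun=> 0); split=> // x.
exact: is_derive_cstf.
Qed.

Lemma smooth_affine f (s t : R) : smooth f -> smooth (fun x => f (s * x + t)).
Proof.
move=> sf n; move: (sf n) => {sf}.
elim: n f => [//|n IH] f [df [fdf sdf]].
exists (fun x => s * df (s * x + t)); split; last exact/uptoZ/IH.
move=> x; have dl : is_derive x 1 (fun y => s * y + t) s.
  apply: (is_derive_eq (is_derive_addf (is_derive_scalef s (is_derive_idf x)) (is_derive_cstf t x))).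
  by rewrite mulr1 addr0.
apply: (is_derive_eq (is_derive_compf (fdf _) dl)); exact: mulrC.
Qed.

Lemma smooth_primitive f g : (forall x, is_derive x 1 f (g x)) -> smooth g ->
  smooth f.
Proof. by move=> fg sg [//|n]; exists g. Qed.

(** The flat function exp (-1/x) together with its products by powers of 1/x: the
    derivatives of [flat m] are linear combinations of such functions. *)
Definition flat m x : R := if 0 < x then x^-1 ^+ m * expR (- x^-1) else 0.

Lemma flat_ge0 m x : 0 <= flat m x.
Proof.
rewrite /flat; case: ifP => // x0.
by rewrite mulr_ge0 ?expR_ge0// exprn_ge0// invr_ge0 ltW.
Qed.

Lemma exp_dominates_power k (y : R) : 0 <= y ->
  y ^+ k.+1 * expR (- y) <= k.+1%:R ^+ k.+1.
Proof.
move=> y0; rewrite expRN ler_pdivrMr ?expR_gt0//.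
have k0 : 0 < k.+1%:R :> R by rewrite ltr0n.
have -> : expR y = expR (y / k.+1%:R) ^+ k.+1.
  by rewrite -expRM_natl mulrC divfK// gt_eqF.
rewrite -exprMn ler_pXn2r ?nnegrE ?mulr_ge0 ?expR_ge0//.
apply: (@le_trans _ _ (k.+1%:R * (y / k.+1%:R))).
  by rewrite mulrC divfK// gt_eqF.
rewrite ler_pM2l//; apply: le_trans (expR_ge1Dx _).
by rewrite lerDr ler01.
Qed.

Lemma is_derive_flat m x :
  is_derive x 1 (flat m) (- m%:R * flat m.+1 x + flat m.+2 x).
Proof.
case: (ltgtP x 0) => x0.
- apply: (@near_eq_is_derive R R R (fun=> 0)).
    by apply: filterS (lt_nbhsl x0) => y y0; rewrite /flat ltNge (ltW y0).
  rewrite /flat ltNge (ltW x0)/= mulr0 addr0; exact: is_derive_cstf.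
- have xn : x != 0 by rewrite gt_eqF.
  have d1 := @is_derive_invf R (fun y => y) x 1 xn (is_derive_idf x).
  have d2 : is_derive x 1 (fun y : R => y^-1 ^+ m) (- m%:R * x^-1 ^+ m.+1).
    elim: m => [|m IH].
      apply: (is_derive_eq (is_derive_cstf 1 x)).
      by rewrite oppr0 mul0r.
    have -> : (fun y : R => y^-1 ^+ m.+1) = (fun y => y^-1 * y^-1 ^+ m).
      by apply/funext => y; rewrite exprS.
    apply: (is_derive_eq (is_derive_mulf d1 IH)).
    by rewrite -natr1 !exprS; field.
  have d3 := @is_derive_compf R expR (fun y => - y^-1) x _ _ (is_derive_expR (- x^-1)) (is_derive_oppf d1).
  apply: (@near_eq_is_derive R R R (fun y => y^-1 ^+ m * expR (- y^-1))).
    by apply: filterS (lt_nbhsr x0) => y y0; rewrite /flat y0.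
  apply: (is_derive_eq (is_derive_mulf d2 d3)).
  by rewrite /flat x0 !exprS; field.
- rewrite x0 /flat ltxx mulr0 addr0 -/(flat m).
  pose K : R := m.+2%:R ^+ m.+2.
  have K0 : 0 < K by rewrite exprn_gt0// ltr0n.
  have fK y : `|flat m y| <= K * `|y| * `|y|.
    rewrite ger0_norm ?flat_ge0// /flat; case: ifP => y0; last first.
      by apply: mulr_ge0 => //; apply: mulr_ge0 => //; exact: ltW.
    have yn : y != 0 by rewrite gt_eqF.
    rewrite gtr0_norm// -ler_pdivrMr// -ler_pdivrMr//.
    apply: le_trans (_ : y^-1 ^+ m.+2 * expR (- y^-1) <= _).
      by rewrite !exprS le_eqVlt; apply/orP; left; apply/eqP; field.
    by apply: exp_dominates_power; rewrite invr_ge0 ltW.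
  apply/is_derive1_caratheodory; exists (fun y => flat m y / y); split.
  + move=> z; rewrite /(flat m 0) ltxx !subr0.
    have [->|z0] := eqVneq z 0; first by rewrite mulr0 /flat ltxx.
    by rewrite divfK.
  + apply/cvgrPdist_le => /= e e0; rewrite invr0 mulr0.
    near=> y; rewrite sub0r normrN normrM normfV.
    have [->|y0] := eqVneq y 0; first by rewrite normr0 invr0 mulr0 ltW.
    rewrite ler_pdivrMr ?normr_gt0//; apply: le_trans (fK y) _.
    rewrite ler_wpM2r// mulrC -ler_pdivlMr//; near: y.
    by apply: cvgr0_norm_le; [exact: cvg_id|exact: divr_gt0].
  + by rewrite /= invr0 mulr0.
Unshelve. all: by end_near. Qed.

Lemma smooth_flat m : smooth (flat m).
Proof.
move=> n; elim: n m => [//|n IH] m.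
exists (fun x => - m%:R * flat m.+1 x + flat m.+2 x); split.
  by move=> x; exact: is_derive_flat.
by apply: uptoD => //; exact: uptoZ.
Qed.

End Smooth.

Section DuBoisReymond.
Context {R : realType}.
Implicit Types (f g h : R -> R) (x y z : R).

Lemma Rintegral_primitive (a b : R) f F : a < b -> continuous f ->
  (forall x, is_derive x 1 F (f x)) ->
  Rintegral lebesgue_measure `]a, b[%classic f = F b - F a.
Proof.
move=> ab cf dF; rewrite /Rintegral (@integral_FTC_oo _ _ F)//.
- exact: continuous_subspaceT.
- by apply: continuous_subspaceT => x; exact: (is_derive_cont (dF x)).
Qed.

(** The primitive H is constant on either side of the support, so that the
    difference of two translates of H is a test function. *)
Lemma bump_exists (s : R) : 0 < s -> exists eta H : R -> R,
  [/\ smooth eta, forall x, 0 <= eta x, forall x, ~~ (0 <= x <= s) -> eta x = 0,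
      forall x, is_derive x 1 H (eta x)
    & exists2 I : R, 0 < I &
        (forall x, x <= 0 -> H x = 0) /\ (forall x, s <= x -> H x = I)].
Proof.
move=> s0; pose eta x := flat 0 (1 * x + 0) * flat 0 (- 1 * x + s).
have seta : smooth eta.
  by apply: smoothM; apply: smooth_affine; exact: smooth_flat.
have eta_ge0 x : 0 <= eta x by rewrite mulr_ge0 ?flat_ge0.
have eta0 x : ~~ (0 <= x <= s) -> eta x = 0.
  rewrite negb_and -!ltNge /eta /flat => /orP[x0|sx].
    by rewrite mul1r addr0 ltNge (ltW x0)/= mul0r.
  by rewrite mulN1r [- x + s]addrC subr_gt0 (ltNge x s) (ltW sx)/= mulr0.
have eta_gt0 x : 0 < x < s -> 0 < eta x.
  move=> /andP[x0 xs]; rewrite /eta /flat mul1r addr0 x0 mulN1r [- x + s]addrC subr_gt0 xs.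
  by rewrite !expr0 !mul1r mulr_gt0 ?expR_gt0.
have ceta : continuous eta.
  by move=> x; have [d [dP _]] := seta 1%N; exact: (is_derive_cont (dP x)).
have [H [H0 dH]] := antiderivative ceta.
have cH : continuous H by move=> x; exact: (is_derive_cont (dH x)).
have cst x y : x <= y -> (forall z, x < z < y -> eta z = 0) -> H x = H y.
  move=> xy z0; apply/esym/eqP; rewrite -subr_eq0 -normr_le0.
  rewrite -[leRHS](mul0r (y - x)).
  apply: (lipschitz_is_derive xy (fun z _ => dH z)); last exact: continuous_subspaceT.
  by move=> z /z0 ->; rewrite normr0.
exists eta, H; split => //; exists (H s); last first.
  split=> x xs.
    rewrite -H0; apply: cst => // z /andP[xz z0].
    by apply: eta0; rewrite negb_and -ltNge z0.
  apply/esym/cst => // z /andP[sz zx].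
  by apply: eta0; rewrite negb_and -!ltNge sz orbT.
have cHs : {within `[0, s], continuous H} by exact: continuous_subspaceT.
have [c /[!in_itv]/= cI] := MVT s0 (fun x _ => dH x) cHs.
by rewrite H0 !subr0 => ->; rewrite mulr_gt0// eta_gt0.
Qed.

(** The difference of two translated bumps is the derivative of a test function,
    and integrating h against it compares averages of h near x and near y.  The
    integral of h * dphi is expressed by a primitive T. *)
Lemma du_bois_reymond_le h x y : continuous h ->
  (forall phi dphi T : R -> R, compact_test_function phi ->
     (forall z, is_derive z 1 phi (dphi z)) -> continuous dphi ->
     (forall z, is_derive z 1 T (h z * dphi z)) -> T pi = T 0) ->
  0 < x -> x < y -> y < pi -> h x <= h y /\ h y <= h x.
Proof.
move=> ch test x0 xy ypi.
(* The sign k treats both inequalities at once. *)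
have main (k : R) : (k = 1 \/ k = -1) -> ~ (k * h y < k * h x).
  move=> kE kh; pose d := (k * h x - k * h y) / 4.
  have d0 : 0 < d by rewrite /d; lra.
  have near_le u : exists2 r : R, 0 < r & forall z, u <= z <= u + r ->
      k * h u - d <= k * h z <= k * h u + d.
    have /cvgrPdist_le/(_ d d0) := ch u.
    case=> r /= r0 Hr; exists (r / 2); first by rewrite divr_gt0.
    move=> z /andP[uz zu].
    have : `|h u - h z| <= d.
      by apply: Hr; rewrite /= distrC ger0_norm ?subr_ge0//; lra.
    by rewrite ler_norml => /andP[h1 h2]; apply/andP; clear -h1 h2 kE; case: kE => ->; split; lra.
  have [r r0 Hr] := near_le x; have [r' r'0 Hr'] := near_le y.
  pose s := Num.min (Num.min r r') ((pi - y) / 2).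
  have s0 : 0 < s by rewrite !lt_min r0 r'0/=; lra.
  have sr : s <= r by rewrite !ge_min lexx.
  have sr' : s <= r' by rewrite !ge_min lexx !orbT.
  have spi : s <= (pi - y) / 2 by rewrite ge_min lexx orbT.
  have [eta [H [seta eta_ge0 eta0 dH [I I0 [Hl Hr0]]]]] := bump_exists s0.
  have ceta : continuous eta.
    by move=> z; have [e [eP _]] := seta 1%N; exact: (is_derive_cont (eP z)).
  have dsh u z : is_derive z 1 (fun z => H (1 * z + - u)) (eta (1 * z + - u)).
    have dl : is_derive z 1 (fun y : R => 1 * y + - u) 1.
      apply: (is_derive_eq (is_derive_addf (is_derive_scalef 1 (is_derive_idf z)) (is_derive_cstf (- u) z))).
      by rewrite mulr1 addr0.
    apply: (is_derive_eq (is_derive_compf (dH _) dl)); exact: mulr1.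
  have ssh u : smooth (fun z => eta (1 * z + - u)) by exact: smooth_affine.
  have csh u : continuous (fun z => eta (1 * z + - u)).
    by move=> z; have [e [eP _]] := ssh u 1%N; exact: (is_derive_cont (eP z)).
  pose phi z := H (1 * z + - x) + (- 1) * H (1 * z + - y).
  pose dphi z := eta (1 * z + - x) + (- 1) * eta (1 * z + - y).
  have dphiP z : is_derive z 1 phi (dphi z).
    by apply: is_derive_addf => //; exact: is_derive_scalef.
  have cdphi : continuous dphi.
    by move=> z; apply: cvgD; [exact: csh|apply: cvgMl_tmp; exact: csh].
  have tphi : compact_test_function phi.
    split.
      apply: smooth_derivable; apply: (smooth_primitive dphiP).
      by apply: smoothD => //; apply: smoothM => //; exact: smooth_cst.
    exists x, (y + s); split=> //; first by lra.
    move=> z; rewrite negb_and -!ltNge => /orP[zx|yz]; rewrite /phi.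
      by rewrite !Hl ?mulr0 ?addr0//; lra.
    by rewrite !Hr0 ?mulN1r ?subrr//; lra.
  have prim u : exists U : R -> R, forall z, is_derive z 1 U (h z * eta (1 * z + - u)).
    have [U [_ dU]] : exists F : R -> R, F 0 = 0 /\ forall z, is_derive z 1 F (h z * eta (1 * z + - u)).
      by apply: antiderivative => z; apply: cvgM; [exact: ch|exact: csh].
    by exists U.
  have [U dU] := prim x; have [V dV] := prim y.
  have UV : U pi + - 1 * V pi = U 0 + - 1 * V 0.
    apply: (test phi dphi (fun z => U z + - 1 * V z)) => // z.
    apply: (is_derive_eq (is_derive_addf (dU z) (is_derive_scalef (- 1) (dV z)))).
    by rewrite /dphi; ring.
  (* Averages against the bump based at u, for h and for - h. *)
  have avg u (a : R) (W : R -> R) : 0 <= u -> u + s <= pi ->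
      (forall z, is_derive z 1 W (h z * eta (1 * z + - u))) ->
      (forall (j : R), (j = k \/ j = - k) ->
         (forall z, u <= z <= u + s -> a <= j * h z) -> a * I <= j * (W pi - W 0)).
    move=> u0 us dW j jk Hj.
    have dQ z : is_derive z 1 (fun z => j * W z + (- a) * H (1 * z + - u))
        ((j * h z - a) * eta (1 * z + - u)).
      apply: (is_derive_eq (is_derive_addf (is_derive_scalef j (dW z)) (is_derive_scalef (- a) (dsh u z)))).
      by ring.
    have : j * W 0 + (- a) * H (1 * 0 + - u) <= j * W pi + (- a) * H (1 * pi + - u).
      apply: (@ge0_is_derive_le R (fun z => j * W z + (- a) * H (1 * z + - u)) _ 0 pi (pi_ge0 R)
        (fun z _ => dQ z)); last first.
        by apply: continuous_subspaceT => z; exact: (is_derive_cont (dQ z)).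
      move=> z _; have [zs|zs] := boolP (0 <= 1 * z + - u <= s).
        rewrite mulr_ge0// subr_ge0; apply: Hj; lra.
      by rewrite eta0 ?mulr0.
    rewrite Hl; last by lra.
    rewrite Hr0; last by lra.
    lra.
  have h1 : (k * h x - d) * I <= k * (U pi - U 0).
    apply: (avg x _ U) => //; [exact: ltW|by lra|by left|].
    move=> z /andP[xz zx]; have /Hr/andP[//] : x <= z <= x + r.
    by rewrite xz (le_trans zx)// lerD2l.
  have h2 : (- (k * h y) - d) * I <= - k * (V pi - V 0).
    apply: (avg y _ V) => //; [by lra|by lra|by right|].
    move=> z /andP[yz zy]; have /Hr'/andP[_] : y <= z <= y + r'.
      by rewrite yz (le_trans zy)// lerD2l.
    by rewrite mulNr; lra.
  have h3 : 0 < d * I by exact: mulr_gt0.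
  have h4 : U pi - U 0 = V pi - V 0 by lra.
  have dE : k * h x = 4 * d + k * h y by rewrite /d; field.
  rewrite h4 dE in h1.
  have e1 : (4 * d + k * h y - d) * I = 3 * (d * I) + k * h y * I by ring.
  have e2 : (- (k * h y) - d) * I = - (k * h y * I) - d * I by ring.
  rewrite e1 in h1; rewrite e2 mulNr in h2.
  have : d * I <= 0 by lra.
  by rewrite leNgt h3.
have m1 := main 1 (or_introl erefl); have m2 := main (- 1) (or_intror erefl).
by split; rewrite leNgt; apply/negP => H; [apply: m1|apply: m2]; lra.
Qed.

(** Subtracting a primitive P of drho from rho leaves a function with vanishing
    weak derivative, which is constant by [du_bois_reymond_le]. *)
Lemma weak_derivative_is_derive (rho drho : R -> R) :
  {within `[0, pi], continuous rho} -> {within `[0, pi], continuous drho} ->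
  weak_derivative rho drho -> forall x, 0 < x < pi -> is_derive x 1 rho (drho x).
Proof.
move=> crho cdrho wd.
pose rc z := rho (clamp 0 pi z); pose dc z := drho (clamp 0 pi z).
have crc : continuous rc := continuous_clamp (pi_ge0 R) crho.
have cdc : continuous dc := continuous_clamp (pi_ge0 R) cdrho.
have [P [_ dP]] := antiderivative cdc.
have cP : continuous P by move=> z; exact: (is_derive_cont (dP z)).
pose h z := rc z + - 1 * P z.
have ch : continuous h by move=> z; apply: cvgD; [exact: crc|apply: cvgMl_tmp; exact: cP].
have test (phi dphi T : R -> R) : compact_test_function phi ->
   (forall z, is_derive z 1 phi (dphi z)) -> continuous dphi ->
   (forall z, is_derive z 1 T (h z * dphi z)) -> T pi = T 0.
  move=> tphi dphiP cdphi dT.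
  have cphi : continuous phi by move=> z; exact: (is_derive_cont (dphiP z)).
  have dphiE : derive1 phi = dphi.
    by apply/funext => z; rewrite derive1E; have [_ ->] := dphiP z.
  have [phi0 phipi] : phi 0 = 0 /\ phi pi = 0.
    have [_ [c [d [c0 dpi H]]]] := tphi; split; apply: H; rewrite negb_and -!ltNge.
      by rewrite c0.
    by rewrite dpi orbT.
  have [Q [_ dQ]] : exists F : R -> R, F 0 = 0 /\ forall z, is_derive z 1 F (rc z * dphi z).
    by apply: antiderivative => z; apply: cvgM; [exact: crc|exact: cdphi].
  have [S [_ dS]] : exists F : R -> R, F 0 = 0 /\ forall z, is_derive z 1 F (dc z * phi z).
    by apply: antiderivative => z; apply: cvgM; [exact: cdc|exact: cphi].
  have QS : Q pi - Q 0 = - (S pi - S 0).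
    have JE (f g : R -> R) : {in `]0, (pi : R)[%classic, f =1 g} ->
      Rintegral lebesgue_measure `]0, pi[%classic f =
      Rintegral lebesgue_measure `]0, pi[%classic g.
      by move=> fg; apply: eq_Rintegral => z zI; exact: fg.
    rewrite -(@Rintegral_primitive 0 pi (fun z => rc z * dphi z))//; first last.
    - by move=> z; apply: cvgM; [exact: crc|exact: cdphi].
    - exact: pi_gt0.
    rewrite -(@Rintegral_primitive 0 pi (fun z => dc z * phi z))//; first last.
    - by move=> z; apply: cvgM; [exact: cdc|exact: cphi].
    - exact: pi_gt0.
    have cid z : z \in `]0, (pi : R)[%classic -> clamp 0 pi z = z.
      rewrite inE/= in_itv/= => /andP[z0 zpi]; by rewrite clamp_id// !ltW.
    have := wd phi tphi; rewrite dphiE => wd'.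
    rewrite (JE _ (fun z => rho z * dphi z)); last by move=> z zI; rewrite /rc cid.
    by rewrite wd' (JE _ (fun z => dc z * phi z))// => z zI; rewrite /dc cid.
  (* T and Q + S - P phi have the same derivative, and phi vanishes at 0 and pi. *)
  pose D z := T z - (Q z + S z - P z * phi z).
  have dD z : is_derive z 1 D 0.
    apply: (is_derive_eq (is_derive_subf (dT z) (is_derive_subf
      (is_derive_addf (dQ z) (dS z)) (is_derive_mulf (dP z) (dphiP z))))).
    by rewrite /h; ring.
  have := is_derive_0_is_cst pi 0 dD.
  by rewrite /D phi0 phipi !mulr0; lra.
move=> x /andP[x0 xpi].
have hx z : 0 < z < pi -> h z = h x.
  move=> /andP[z0 zpi]; case: (ltgtP z x) => [zx|xz|->//].
    by have [? ?] := du_bois_reymond_le ch test z0 zx xpi; apply/eqP; rewrite eq_le; apply/andP.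
  by have [? ?] := du_bois_reymond_le ch test x0 xz zpi; apply/eqP; rewrite eq_le; apply/andP.
apply: (@near_eq_is_derive R R R (fun z => P z + h x)).
  have : \forall z \near x, 0 < z < pi.
    by near=> z; apply/andP; split; near: z; [exact: lt_nbhsr|exact: lt_nbhsl].
  apply: filterS => z zI; rewrite -(hx z zI) /h /rc clamp_id; first by ring.
  by case/andP: zI => *; rewrite !ltW.
apply: (is_derive_eq (is_derive_addf (dP x) (is_derive_cstf (h x) x))).
by rewrite addr0 /dc clamp_id// !ltW.
Unshelve. all: by end_near. Qed.

End DuBoisReymond.

(** * Integration over the rectangle *)

Lemma continuous_pairf (U V W : topologicalType) (f : U -> V) (g : U -> W) :
  continuous f -> continuous g -> continuous (fun z => (f z, g z)).
Proof. by move=> cf cg z; exact: (cvg_pair (cf z) (cg z)). Qed.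

Section Rectangle.
Context {R : realType}.
Local Notation leb := (@lebesgue_measure R).
Local Notation leb2 := (leb \x leb)%E.

(** An open set is the union of the open boxes with rational corners that it
    contains. *)
Lemma open_measurable2 (U : set (R * R)) : open U -> measurable U.
Proof.
move=> oU.
pose box (q : (rat * rat) * (rat * rat)) : set (R * R) :=
  `]ratr q.1.1, ratr q.1.2[%classic `*` `]ratr q.2.1, ratr q.2.2[%classic.
pose F q := if `[< box q `<=` U >] then box q else set0.
have -> : U = \bigcup_q F q.
  apply/seteqP; split => [[x y] Uxy|z [q _]]; last first.
    by rewrite /F; case: ifPn => // /asboolP; exact.
  have /nbhs_ballP[e /= e0 eU] := open_nbhs_nbhs (conj oU Uxy).
  have lo t : t - e < t by rewrite gtrDl oppr_lt0.
  have hi t : t < t + e by rewrite ltrDl.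
  have [a1 /[!in_itv]/= /andP[xa1 a1x]] := rat_in_itvoo (lo x).
  have [b1 /[!in_itv]/= /andP[xb1 b1x]] := rat_in_itvoo (hi x).
  have [a2 /[!in_itv]/= /andP[ya2 a2y]] := rat_in_itvoo (lo y).
  have [b2 /[!in_itv]/= /andP[yb2 b2y]] := rat_in_itvoo (hi y).
  exists ((a1, b1), (a2, b2)) => //; rewrite /F.
  have -> : `[< box ((a1, b1), (a2, b2)) `<=` U >].
    apply/asboolP => -[s t] [/=]; rewrite !in_itv/= => /andP[h1 h2] /andP[h3 h4].
    by apply: eU; split; rewrite /ball/= ltr_norml; lra.
  by split; rewrite /= in_itv/= ?a1x ?a2y.
apply: countable_bigcupT_measurable; first exact: countableP.
move=> q; rewrite /F; case: ifPn => // _.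
by apply: measurableX; exact: measurable_itv.
Qed.

Lemma continuous_measurable2 (f : R * R -> R) : continuous f ->
  measurable_fun setT f.
Proof.
move=> /continuousP cf.
apply: (measurability _ (measurable_realfun.RGenOpens.measurableE R)).
move=> _ [_ [a [b ->] <-]]; rewrite setTI; apply: open_measurable2.
exact/cf/interval_open.
Qed.

Variable T : R.
Hypothesis T0 : 0 < T.
Implicit Types f : R * R -> R.

Lemma Omega_sub : Omega T `<=` Omega_bar T.
Proof.
by case=> t x [/=]; rewrite !in_itv/= => /andP[? ?] /andP[? ?]; split; rewrite /= in_itv/= !ltW.
Qed.

Lemma measurable_Omega : measurable (Omega T : set (R * R)).
Proof. by apply: measurableX; exact: measurable_itv. Qed.

Lemma leb2_Omega : leb2 (Omega T) = (T * pi)%:E.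
Proof.
rewrite product_measure1E; [|exact: measurable_itv|exact: measurable_itv].
by rewrite /= !lebesgue_measure_itv/= !lte_fin T0 pi_gt0 !oppr0 !adde0 -EFinM.
Qed.

(** Composed with the projection of the plane onto the closed rectangle, f becomes
    continuous everywhere. *)
Lemma within_bar_measurable f : {within Omega_bar T, continuous f} ->
  measurable_fun (Omega T) f.
Proof.
move=> cf; pose c (z : R * R) := (clamp 0 T z.1, clamp 0 pi z.2).
have cc : continuous c.
  apply: continuous_pairf => z.
    by apply: (@continuous_comp _ _ _ fst (clamp 0 T)); [exact: cvg_fst|exact: clamp_continuous].
  by apply: (@continuous_comp _ _ _ snd (clamp 0 pi)); [exact: cvg_snd|exact: clamp_continuous].
have cfc : continuous (fun z => f (c z)).
  apply: within_continuousT; apply: (within_continuous_retract (A := Omega_bar T)) => //.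
  by move=> z _; split; rewrite /= in_itv/= clamp_itv ?pi_ge0// ltW.
apply: (@eq_measurable_fun _ _ _ _ _ (fun z => f (c z))).
  move=> [t x] /[!inE] /Omega_sub [/=]; rewrite !in_itv/= => tT xpi.
  by rewrite /c/= !clamp_id.
by apply: measurable_funTS; exact: continuous_measurable2.
Qed.

Lemma bounded_bar f : {within Omega_bar T, continuous f} ->
  exists2 M : R, 0 < M & forall z, Omega_bar T z -> `|f z| <= M.
Proof.
move=> cf; have co : compact (Omega_bar T).
  by apply: compact_setX; exact: segment_compact.
have ne : Omega_bar T !=set0.
  by exists (0, 0); split; rewrite /= in_itv/= lexx ?pi_ge0// ltW.
have [c _ cM] := compact_EVT_max ne co (within_continuous_comp cf (@norm_continuous _ R)).
exists (`|f c| + 1); first by rewrite ltr_wpDl.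
by move=> z zb; apply: le_trans (cM z _) _; rewrite ?inE// lerDl.
Qed.

Lemma within_bar_integrable f : {within Omega_bar T, continuous f} ->
  leb2.-integrable (Omega T) (EFin \o f).
Proof.
move=> cf; apply: measurable_bounded_integrable.
- exact: measurable_Omega.
- by move: (ltry (T * pi)); rewrite -leb2_Omega; apply.
- exact: within_bar_measurable.
- have [M M0 fM] := bounded_bar cf.
  exists M; split; first exact: num_real.
  by move=> N MN z zO; apply: le_trans (ltW MN); exact/fM/Omega_sub.
Qed.

Lemma Rintegral_rect_t f : {within Omega_bar T, continuous f} ->
  (forall x, 0 < x < pi -> (\int[leb]_(t in `]0%R, T[) (f (t, x))%:E = 0)%E) ->
  Rintegral leb2 (Omega T) f = 0.
Proof.
move=> cf f0; rewrite /Rintegral integral_mkcond.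
have fi := within_bar_integrable cf.
rewrite -(integral21_prod_meas1 (m1 := leb) (m2 := leb)); last first.
  exact: ((integrable_mkcond (mu := leb2) (EFin \o f) measurable_Omega).1 fi).
rewrite integral0_eq// => x _; rewrite /fubini_G.
case: (boolP (0 < x < pi)) => xI.
  rewrite -(f0 x xI) [RHS]integral_mkcond; apply: eq_integral => t _.
  rewrite !patchE; congr (if _ then _ else _).
  by apply/idP/idP; rewrite !inE /Omega/= !in_itv/= ?xI; [case|split].
rewrite integral0_eq// => t _; rewrite patchE ifF//; apply/negbTE.
by apply: contra xI; rewrite inE => -[_]; rewrite /= in_itv.
Qed.

Lemma Rintegral_rect_x f : {within Omega_bar T, continuous f} ->
  (forall t, 0 < t < T -> (\int[leb]_(x in `]0%R, pi[) (f (t, x))%:E = 0)%E) ->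
  Rintegral leb2 (Omega T) f = 0.
Proof.
move=> cf f0; rewrite /Rintegral integral_mkcond.
have fi := within_bar_integrable cf.
rewrite -(integral12_prod_meas1 (m1 := leb) (m2 := leb)); last first.
  exact: ((integrable_mkcond (mu := leb2) (EFin \o f) measurable_Omega).1 fi).
rewrite integral0_eq// => t _; rewrite /fubini_F.
case: (boolP (0 < t < T)) => tI.
  rewrite -(f0 t tI) [RHS]integral_mkcond; apply: eq_integral => x _.
  rewrite !patchE; congr (if _ then _ else _).
  by apply/idP/idP; rewrite !inE /Omega/= !in_itv/= ?tI; [case|split].
rewrite integral0_eq// => x _; rewrite patchE ifF//; apply/negbTE.
by apply: contra tI; rewrite inE => -[]; rewrite /= in_itv.
Qed.

Lemma within_bar_section_t f x : 0 <= x <= pi -> {within Omega_bar T, continuous f} ->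
  {within `[0, T], continuous (fun t => f (t, x))}.
Proof.
move=> xI; apply: within_continuous_retract.
  by apply: continuous_pairf => t; [exact: cvg_id|exact: cvg_cst].
by move=> t tI; split; rewrite //= in_itv.
Qed.

Lemma within_bar_section_x f t : 0 <= t <= T -> {within Omega_bar T, continuous f} ->
  {within `[0, pi], continuous (fun x => f (t, x))}.
Proof.
move=> tI; apply: within_continuous_retract.
  by apply: continuous_pairf => x; [exact: cvg_cst|exact: cvg_id].
by move=> x xI; split; rewrite //= in_itv.
Qed.

Lemma within_bar_snd (w : R -> R) : {within `[0, pi], continuous w} ->
  {within Omega_bar T, continuous (fun z => w z.2)}.
Proof.
apply: within_continuous_retract; first by move=> z; exact: cvg_snd.
by move=> z [].
Qed.

(** By Fubini's theorem and the fundamental theorem of calculus on each line; the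
    next lemma exchanges the roles of the variables. *)
Lemma Rintegral_dt_eq0 h f :
  {within Omega_bar T, continuous h} -> {within Omega_bar T, continuous f} ->
  (forall t x, Omega T (t, x) -> is_derive t 1 (fun s => h (s, x)) (f (t, x))) ->
  (forall x, 0 < x < pi -> h (0, x) = h (T, x)) ->
  Rintegral leb2 (Omega T) f = 0.
Proof.
move=> ch cf dh hT; apply: Rintegral_rect_t => // x xI.
have xI' : 0 <= x <= pi by case/andP: xI => *; rewrite !ltW.
apply: etrans (integral_FTC_oo T0 (within_bar_section_t xI' cf)
  (within_bar_section_t xI' ch) _) _; last by rewrite hT// subrr.
by move=> t tI; apply: dh; split; rewrite /= in_itv.
Qed.

Lemma Rintegral_dx_eq0 h f :
  {within Omega_bar T, continuous h} -> {within Omega_bar T, continuous f} ->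
  (forall t x, Omega T (t, x) -> is_derive x 1 (fun y => h (t, y)) (f (t, x))) ->
  (forall t, 0 < t < T -> h (t, 0) = h (t, pi)) ->
  Rintegral leb2 (Omega T) f = 0.
Proof.
move=> ch cf dh hT; apply: Rintegral_rect_x => // t tI.
have tI' : 0 <= t <= T by case/andP: tI => *; rewrite !ltW.
apply: etrans (integral_FTC_oo (pi_gt0 R) (within_bar_section_x tI' cf)
  (within_bar_section_x tI' ch) _) _; last by rewrite hT// subrr.
by move=> x xI; apply: dh; split; rewrite /= in_itv.
Qed.

End Rectangle.

(** * Stationary solutions are weak solutions *)

Section Stationary.
Context {R : realType}.
Local Notation leb := (@lebesgue_measure R).
Local Notation leb2 := (leb \x leb)%E.
Variables (T : R) (rho drho : R -> R).
Hypothesis T0 : 0 < T.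
Hypothesis rho_cont : {within `[0, pi], continuous rho}.
Hypothesis drho_cont : {within `[0, pi], continuous drho}.
Hypothesis rho_gt0 : forall x, 0 <= x <= pi -> 0 < rho x.
Hypothesis rho_der : forall x, 0 < x < pi -> is_derive x 1 rho (drho x).
Variables (p mu : R).
Hypothesis p01 : 0 < p < 1.

Lemma Omega_itv t x : Omega T (t, x) -> 0 < t < T /\ 0 < x < pi.
Proof. by case; rewrite /= !in_itv. Qed.

Lemma norm_powR_p1 (s : R) : `|s| `^ (p + 1) = s * signed_power p s.
Proof.
have p0 : 0 < p by case/andP: p01.
rewrite signed_powerE// mulrA [s * _]mulrC -normrEsg addrC powRD ?powRr1//.
by rewrite gt_eqF ?addr_gt0.
Qed.

Let density_continuous (w : R -> R) : {within `[0, pi], continuous w} ->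
  {within Omega_bar T, continuous (fun z => `|w z.2| `^ (p + 1) * rho z.2)}.
Proof.
move=> cw; apply: within_continuousM; last exact: within_bar_snd.
have -> : (fun z : R * R => `|w z.2| `^ (p + 1)) =
    (fun z => w z.2 * signed_power p (w z.2)).
  by apply/funext => z; exact: norm_powR_p1.
apply: within_continuousM; first exact: within_bar_snd.
by apply: within_continuous_comp; [exact: within_bar_snd|exact: signed_power_continuous].
Qed.

Lemma stationary_in_Lr (w : R -> R) : {within `[0, pi], continuous w} ->
  in_Lr T rho (p + 1) (fun z => w z.2).
Proof.
move=> cw; split.
  by apply: (within_bar_measurable T0); exact: within_bar_snd.
apply: (integrable_lty (mu := leb2)); first exact: measurable_Omega.
exact: (within_bar_integrable T0 (density_continuous cw)).
Qed.

Lemma stationary_Lr_le (w : R -> R) (beta0 e : R) : {within `[0, pi], continuous w} ->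
  (forall x, 0 <= x <= pi -> `|w x| <= e) -> e <= 1 ->
  (forall x, 0 <= x <= pi -> rho x <= beta0) ->
  (Lr_integral T rho (p + 1) (fun z => w z.2) <= (e * beta0 * (T * pi))%:E)%E.
Proof.
move=> cw we e1 rb; have p0 : 0 < p by case/andP: p01.
have zpi : 0 <= (0 : R) <= pi by apply/andP; split => //; exact: pi_ge0.
have e0 : 0 <= e := le_trans (normr_ge0 _) (we 0 zpi).
have b0 : 0 <= beta0 := le_trans (ltW (rho_gt0 zpi)) (rb 0 zpi).
have mO := measurable_Omega T.
rewrite /Lr_integral.
apply: (@le_trans _ _ (\int[leb2]_(z in Omega T) (cst (e * beta0)%:E z))%E).
  have OI z : Omega T z -> 0 <= z.2 <= pi.
    by case: z => t x /Omega_itv[_ /andP[? ?]]; rewrite !ltW.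
  apply: ge0_le_integral => //.
  - by move=> z /OI zI; rewrite lee_fin mulr_ge0 ?powR_ge0// ltW// rho_gt0.
  - by apply/measurable_realfun.measurable_EFinP; apply: (within_bar_measurable T0); exact: density_continuous.
  - move=> z /OI zI; rewrite lee_fin; apply: ler_pM => //.
    + by rewrite ltW// rho_gt0.
    + rewrite addrC powRD ?powRr1//; last by rewrite gt_eqF ?addr_gt0.
      rewrite -[leRHS]mulr1; apply: ler_pM => //; first exact: we.
      suff : `|w z.2| `^ p <= 1 `^ p by rewrite powR1.
      apply: ge0_ler_powR; rewrite ?nnegrE//; first exact: ltW.
      exact: le_trans (we _ zI) e1.
    + exact: rb.
rewrite integral_cst//.
apply: (@le_trans _ _ ((e * beta0)%:E * (T * pi)%:E)%E); last by rewrite -EFinM.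
by rewrite -(leb2_Omega T0).
Qed.

(** The integrand of the weak formulation is the t-derivative of w rho psi_t, which
    is T-periodic, minus the x-derivative of w rho psi_x - v psi, which vanishes at
    both ends because w and psi satisfy the same boundary conditions. *)
Lemma stationary_weak_solution (a1 b1 a2 b2 : R) (w v : R -> R) :
  b1 != 0 -> b2 != 0 ->
  {within `[0, pi], continuous w} -> {within `[0, pi], continuous v} ->
  (forall x, 0 < x < pi -> is_derive x 1 w (v x / rho x)) ->
  (forall x, 0 < x < pi ->
     is_derive x 1 v (- (rho x * (mu * w x + signed_power p (w x))))) ->
  v 0 = - (a1 * rho 0 / b1) * w 0 -> a2 * rho pi * w pi + b2 * v pi = 0 ->
  weak_solution T rho a1 b1 a2 b2 mu p (p + 1) (fun z => w z.2).
Proof.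
move=> b10 b20 cw cv dw dv v0 vpi; split.
- by rewrite lerDr ltW//; case/andP: p01.
- exact: stationary_in_Lr.
move=> psi [smooth bc1 bc2 per0 per1].
have cpsi m n : {within Omega_bar T, continuous (psi m n)} by have [] := smooth m n.
have W := @within_bar_snd R T w cw; have V := @within_bar_snd R T v cv.
have D := @within_bar_snd R T drho drho_cont; have P := @within_bar_snd R T rho rho_cont.
have N : {within Omega_bar T, continuous (fun z : R * R => signed_power p (w z.2))}.
  by apply: within_continuous_comp => //; exact: signed_power_continuous.
have MU := @within_continuous_cst R _ (Omega_bar T) mu.
pose A (z : R * R) := w z.2 * rho z.2 * psi 2%N 0%N z.
pose B z := w z.2 * (drho z.2 * psi 0%N 1%N z + rho z.2 * psi 0%N 2%N z) +
            rho z.2 * (mu * w z.2 + signed_power p (w z.2)) * psi 0%N 0%N z.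
pose F1 z := w z.2 * (rho z.2 * psi 2%N 0%N z -
             (drho z.2 * psi 0%N 1%N z + rho z.2 * psi 0%N 2%N z)).
pose F2 z := (mu * w z.2 + signed_power p (w z.2)) * psi 0%N 0%N z * rho z.2.
have cA : {within Omega_bar T, continuous A}.
  by apply: within_continuousM; [exact: within_continuousM|exact: cpsi].
have cDP : {within Omega_bar T, continuous
    (fun z => drho z.2 * psi 0%N 1%N z + rho z.2 * psi 0%N 2%N z)}.
  by apply: within_continuousD; apply: within_continuousM => //; exact: cpsi.
have cG : {within Omega_bar T, continuous (fun z : R * R => mu * w z.2 + signed_power p (w z.2))}.
  by apply: within_continuousD => //; exact: within_continuousM.
have cB : {within Omega_bar T, continuous B}.
  apply: within_continuousD; first exact: within_continuousM.
  by apply: within_continuousM; [exact: within_continuousM|exact: cpsi].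
have cF1 : {within Omega_bar T, continuous F1}.
  apply: within_continuousM => //; apply: within_continuousB => //.
  by apply: within_continuousM => //; exact: cpsi.
have cF2 : {within Omega_bar T, continuous F2}.
  by apply: within_continuousM => //; apply: within_continuousM => //; exact: cpsi.
have mO := measurable_Omega T.
rewrite (@eq_Rintegral _ _ _ leb2 (Omega T) F1); last first.
  move=> [t x]; rewrite inE => tx; have [tI xI] := Omega_itv tx.
  rewrite /F1 /=; congr (_ * (_ - _)).
  have [_ _ dx] := smooth 0%N 1%N.
  have H := is_derive_mulf (rho_der xI) (dx t x tx).
  by rewrite derive1E; have [_ ->] := H.
rewrite -[X in _ - X]/(Rintegral leb2 (Omega T) F2).
rewrite -RintegralB//; [|exact: within_bar_integrable|exact: within_bar_integrable].
rewrite (@eq_Rintegral _ _ _ leb2 (Omega T) (fun z => A z - B z)); last first.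
  by move=> z _; rewrite /F1 /F2 /A /B; ring.
rewrite RintegralB//; [|exact: within_bar_integrable|exact: within_bar_integrable].
have -> : Rintegral leb2 (Omega T) A = 0.
  apply: (@Rintegral_dt_eq0 _ T T0 (fun z => w z.2 * rho z.2 * psi 1%N 0%N z)) => //.
  - by apply: within_continuousM; [exact: within_continuousM|exact: cpsi].
  - move=> t x tx; have [_ dt _] := smooth 1%N 0%N.
    exact: (is_derive_scalef (w x * rho x) (dt t x tx)).
  - by move=> x /andP[x0 xpi]; rewrite /= per1//; apply/andP; split; exact: ltW.
have -> : Rintegral leb2 (Omega T) B = 0; last by rewrite subrr.
apply: (@Rintegral_dx_eq0 _ T T0
  (fun z => w z.2 * rho z.2 * psi 0%N 1%N z - v z.2 * psi 0%N 0%N z)) => //.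
- apply: within_continuousB; apply: within_continuousM => //; try exact: cpsi.
  exact: within_continuousM.
- move=> t x tx; have [tI xI] := Omega_itv tx.
  have [_ _ dx1] := smooth 0%N 1%N; have [_ _ dx0] := smooth 0%N 0%N.
  have rn : rho x != 0 by rewrite gt_eqF// rho_gt0//; case/andP: xI => *; rewrite !ltW.
  apply: (is_derive_eq (is_derive_subf
    (is_derive_mulf (is_derive_mulf (dw x xI) (rho_der xI)) (dx1 t x tx))
    (is_derive_mulf (dv x xI) (dx0 t x tx)))).
  by rewrite /B /=; field.
- move=> t /andP[t0 tT]; have tI : 0 <= t <= T by rewrite !ltW.
  have rpi : rho pi != 0 by rewrite gt_eqF// rho_gt0// pi_ge0 lexx.
  have e1 : psi 0%N 1%N (t, 0) = - (a1 / b1) * psi 0%N 0%N (t, 0).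
    apply: (mulfI b10); rewrite mulrA mulrN mulrCA divff// mulr1.
    by have := bc1 t tI; lra.
  have e2 : psi 0%N 1%N (t, pi) = - (a2 / b2) * psi 0%N 0%N (t, pi).
    apply: (mulfI b20); rewrite mulrA mulrN mulrCA divff// mulr1.
    by have := bc2 t tI; lra.
  have e3 : v pi = - (a2 * rho pi / b2) * w pi.
    apply: (mulfI b20); rewrite mulrA mulrN mulrCA divff// mulr1.
    by have := vpi; lra.
  rewrite /= e1 e2 e3 v0; field; rewrite ?b10 ?b20//.
Qed.

End Stationary.

(** * Infinitely many solutions *)

Section Conclusion.
Context {R : realType}.
Local Notation leb := (@lebesgue_measure R).
Local Notation leb2 := (leb \x leb)%E.

(** The integrand is only almost everywhere positive, so that its positive part is
    integrated instead. *)
Lemma Rintegral_eta_ge0 (rho drho ddrho : R -> R) :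
  H2 rho drho ddrho -> (forall x, 0 <= x <= pi -> 0 < rho x) ->
  (0 < rho0 rho drho ddrho)%E ->
  0 <= Rintegral leb `]0, pi[%classic (eta rho drho ddrho).
Proof.
move=> [[crho cdrho] _ _ [mddrho _] _] rho_gt0 /ereal_sup_gt[y /= etay y0].
have mJ : measurable (`]0, pi[%classic : set R) := measurable_itv _.
have within_measurable (f : R -> R) : {within `[0, pi], continuous f} ->
    measurable_fun `]0, pi[%classic f.
  move=> cf; apply: (@measurable_funS _ _ _ _ `[0, pi]%classic) => //.
    exact: subset_itv_oo_cc.
  exact: measurable_realfun.subspace_continuous_measurable_fun.
have cirho : {within `[0, pi], continuous (fun x => (rho x)^-1)}.
  apply/subspace_continuousP => x xI; apply: cvgV.
    by rewrite gt_eqF// rho_gt0//; move: xI; rewrite /= in_itv.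
  by move/subspace_continuousP : crho; apply.
have mirho := within_measurable _ cirho; have mdrho := within_measurable _ cdrho.
pose f := eta rho drho ddrho.
have mf : measurable_fun `]0, pi[%classic f.
  have md := measurable_realfun.measurable_funM mdrho mirho.
  have mdd := measurable_realfun.measurable_funM mddrho mirho.
  apply: measurable_realfun.measurable_funB.
    by apply: measurable_realfun.measurable_funM => //; exact: measurable_cst.
  apply: measurable_realfun.measurable_funM; first exact: measurable_cst.
  exact: (measurable_realfun.measurable_funM md md).
rewrite /Rintegral fine_ge0//.
rewrite (_ : (\int[_]_(x in _) _)%E = (\int[leb]_(x in `]0%R, pi[) ((EFin \o f)^\+ x))%E).
  by apply: integral_ge0 => x _; exact: funepos_ge0.
apply: ae_eq_integral => //.
- exact/measurable_realfun.measurable_EFinP.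
- by apply: measurable_realfun.measurable_funepos; exact/measurable_realfun.measurable_EFinP.
case: etay => A [mA A0 yA]; exists (A `&` `]0, pi[%classic); split.
- exact: measurableI.
- exact: A0.
- move=> x /= H.
  have [xJ|xJ] := pselect (`]0, (pi : R)[%classic x); last by exfalso; apply: H.
  split=> //; apply: yA => /= yf; apply: H => _.
  by rewrite funeposE/= max_l// (le_trans (ltW y0)).
Qed.

End Conclusion.

(** By continuity the functions differ on a strip along the side x = 0, which has
    positive measure. *)
Lemma stationary_not_ae_equal {R : realType} (T : R) (w1 w2 : R -> R) : 0 < T ->
  {within `[0, pi], continuous w1} -> {within `[0, pi], continuous w2} ->
  w1 0 != w2 0 -> ~ ae_equal T (fun z => w1 z.2) (fun z => w2 z.2).
Proof.
move=> T0 c1 c2 w12 [N [mN N0 subN]].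
have cd := within_continuousB c1 c2.
have [_ d0 _] := (continuous_within_itvP (fun x => w1 x - w2 x) (pi_gt0 R)).1 cd.
have e0 : 0 < `|w1 0 - w2 0| by rewrite normr_gt0 subr_eq0.
move/cvgrPdist_lt : d0 => /(_ _ e0) [r /= r0 Hr].
pose s := Num.min r pi; have s0 : 0 < s by rewrite lt_min r0 pi_gt0.
pose strip : set (R * R) := `]0, T[%classic `*` `]0, s[%classic.
have stripN : strip `<=` N.
  move=> [t x] [/=]; rewrite !in_itv/= => tI /andP[x0].
  rewrite lt_min => /andP[xr xpi]; apply: subN => /= H.
  have /H/eqP wx : Omega T (t, x) by split; rewrite /= in_itv//= x0.
  have : `|w1 0 - w2 0 - (w1 x - w2 x)| < `|w1 0 - w2 0|.
    by apply: Hr => //=; rewrite sub0r normrN gtr0_norm.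
  by move/eqP : wx => ->; rewrite subrr subr0 ltxx.
have mstrip : measurable strip by apply: measurableX; exact: measurable_itv.
have stripE : ((@lebesgue_measure R \x @lebesgue_measure R) strip = (T * s)%:E)%E.
  rewrite product_measure1E; [|exact: measurable_itv|exact: measurable_itv].
  by rewrite /= !lebesgue_measure_itv/= !lte_fin T0 s0 !oppr0 !adde0 -EFinM.
have : ((@lebesgue_measure R \x @lebesgue_measure R) strip <=
        (@lebesgue_measure R \x @lebesgue_measure R) N)%E.
  by apply: le_measure; rewrite ?inE.
rewrite N0 stripE lee_fin leNgt => /negP; apply; exact: mulr_gt0.
Qed.

Theorem theorem2p4 (R : realType) (a b : nat) (T a1 b1 a2 b2 : R)
    (rho drho ddrho : R -> R) (beta0 p mu : R)
    (ha : (0 < a)%N) (hb : (0 < b)%N) (hab : coprime a b)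
    (hT : T = 2 * pi * a%:R / b%:R)
    (hbc1 : a1 ^+ 2 + b1 ^+ 2 != 0) (hbc2 : a2 ^+ 2 + b2 ^+ 2 != 0)
    (hrhoH2 : H2 rho drho ddrho)
    (hrho : forall x, 0 <= x <= pi -> 0 < rho x <= beta0)
    (hrho0 : (0 < rho0 rho drho ddrho)%E)
    (hp : 0 < p < 1)
    (halpha1 : 0 < alpha1 rho drho a1 b1) (hbeta1 : 0 < beta1 b1)
    (halpha2 : 0 < alpha2 rho drho a2 b2) (hbeta2 : 0 < beta2 b2)
    (hmu : ~ Lambda rho a1 b1 a2 b2 T mu)
    (hmu4 : 2 * rho4 rho drho ddrho a1 b1 a2 b2 < mu) :
  exists u : nat -> R * R -> R,
    [/\ forall l, weak_solution T rho a1 b1 a2 b2 mu p (p + 1) (u l),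
        forall l m, l <> m -> ~ ae_equal T (u l) (u m)
      & Lr_integral T rho (p + 1) (u l) @[l --> \oo] --> 0%E].
Proof.
have pi0 := pi_gt0 R.
have T0 : 0 < T by rewrite hT divr_gt0 ?ltr0n// mulr_gt0 ?ltr0n// mulr_gt0.
have rho_gt0 x : 0 <= x <= pi -> 0 < rho x by case/hrho/andP.
have rho_le x : 0 <= x <= pi -> rho x <= beta0 by case/hrho/andP.
have [[crho cdrho] _ _ _ [wd _]] := hrhoH2.
have rho_der := weak_derivative_is_derive crho cdrho wd.
have mu0 : 0 < mu.
  apply: le_lt_trans hmu4; rewrite mulr_ge0// /rho4 mulr_ge0 ?invr_ge0 ?pi_ge0//.
  have := Rintegral_eta_ge0 hrhoH2 rho_gt0 hrho0.
  have := divr_gt0 halpha1 hbeta1; have := divr_gt0 halpha2 hbeta2.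
  lra.
have b10 : b1 != 0 by move: hbeta1; rewrite /beta1 oppr_gt0 => /lt_eqF->.
have b20 : b2 != 0 by move: hbeta2; rewrite /beta2 => /gt_eqF->.
pose small (e : R) (wv : (R -> R) * (R -> R)) :=
  [/\ {within `[0, pi], continuous wv.1} /\ {within `[0, pi], continuous wv.2},
      forall x, 0 < x < pi -> is_derive x 1 wv.1 (wv.2 x / rho x),
      forall x, 0 < x < pi ->
        is_derive x 1 wv.2 (- (rho x * (mu * wv.1 x + signed_power p (wv.1 x)))),
      wv.2 0 = - (a1 * rho 0 / b1) * wv.1 0 /\
        a2 * rho pi * wv.1 pi + b2 * wv.2 pi = 0
    & (forall x, 0 <= x <= pi -> `|wv.1 x| <= e) /\ wv.1 0 != 0].
have /choice[sol solP] : forall e : R, exists wv, 0 < e -> small e wv.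
  move=> e; case: (ltP 0 e) => e0; last by exists (id, id) => ?; lra.
  have [w [v wvP]] := small_stationary_solution pi0 crho cdrho rho_gt0 rho_der hp mu0
    (- (a1 * rho 0 / b1)) (a2 * rho pi) b2 e0.
  by exists (w, v).
(* Each solution is to be smaller than the value at 0 of the preceding one, and
   the bounds are to decrease geometrically. *)
pose next e := Num.min e `|(sol e).1 0| / 2.
pose eps l := iter l next 1.
have eps_gt0 l : 0 < eps l.
  elim: l => [|l IH]; first exact: ltr01.
  have [_ _ _ _ [_ nz]] := solP _ IH.
  by rewrite /eps iterS -/(eps l) /next divr_gt0// lt_min IH normr_gt0.
have epsS l : eps l.+1 <= eps l / 2 /\ eps l.+1 <= `|(sol (eps l)).1 0| / 2.
  by rewrite /eps iterS -/(eps l) /next !ler_pM2r// !ge_min !lexx orbT.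
have eps_decr l k : eps (l + k)%N <= eps l.
  elim: k => [|k IH]; first by rewrite addn0.
  rewrite addnS; have [+ _] := epsS (l + k)%N; have := eps_gt0 (l + k)%N; lra.
have eps_le l : eps l <= 2^-1 ^+ l.
  elim: l => [|l IH]; first by rewrite expr0.
  by have [+ _] := epsS l; rewrite exprS; lra.
have cvg_eps : eps l @[l --> \oo] --> (0 : R).
  apply: (squeeze_cvgr (f := fun=> 0) (h := fun l => 2^-1 ^+ l)).
  - by apply: nearW => l; rewrite ltW//= eps_le.
  - exact: cvg_cst.
  - by apply: cvg_expr; rewrite ger0_norm ?invr_ge0//; lra.
pose w l := (sol (eps l)).1.
exists (fun l z => w l z.2); split.
- move=> l; have [[cw cv] dw dv [v0 vpi] _] := solP _ (eps_gt0 l).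
  exact: (stationary_weak_solution T0 crho cdrho rho_gt0 rho_der hp b10 b20 cw cv dw dv v0 vpi).
- have distinct l m : (l < m)%N -> w l 0 != w m 0.
    move=> lm; have [_ wl] := epsS l.
    have [_ _ _ _ [wm _]] := solP _ (eps_gt0 m).
    have := wm 0; rewrite lexx pi_ge0 => /(_ isT) wm0.
    have em : eps m <= eps l.+1 by rewrite -(subnKC lm); exact: eps_decr.
    have [_ _ _ _ [_ nz]] := solP _ (eps_gt0 l).
    have n0 : 0 < `|w l 0| by rewrite normr_gt0.
    apply: contraTneq wm0 => wlm; rewrite -ltNge -/(w m) -wlm.
    by move: wl; rewrite -/(w l); lra.
  have cw l : {within `[0, pi], continuous (w l)}.
    by have [[]] := solP _ (eps_gt0 l).
  move=> l m lm; apply: stationary_not_ae_equal => //.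
  by case: (ltngtP l m) lm => // lm _; [|rewrite eq_sym]; exact: distinct.
- apply: (squeeze_cvge (f := fun=> 0%E) (h := fun l => (eps l * beta0 * (T * pi))%:E)).
  + apply: nearW => l; apply/andP; split.
      apply: integral_ge0 => -[t x] tx; have [_ /andP[x0 xpi]] := Omega_itv tx.
      by rewrite lee_fin mulr_ge0 ?powR_ge0// ltW// rho_gt0// !ltW.
    have [[cw cv] _ _ _ [we _]] := solP _ (eps_gt0 l).
    apply: stationary_Lr_le => //.
    by apply: le_trans (eps_le l) _; rewrite exprn_ile1 ?invr_ge0//; lra.
  + exact: cvg_cst.
  + apply: cvg_EFin; first exact: nearW.
    have -> : 0 = 0 * beta0 * (T * pi) :> R by rewrite !mul0r.
    by apply: cvgMr_tmp; apply: cvgMr_tmp; exact: cvg_eps.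
Qed.
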